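(* Let $\mu$ be a finite Borel measure on $(-\pi,\pi)$ and $\mu^\#$ its symmetrization, and let $u_\mu,u_{\mu^\#}$ be the solutions of the Dirichlet problem $-u''=\mu$ (distributions on $(-\pi,\pi)$), $u(\pm\pi)=0$. Then $\|u_\mu\|_{L^p}\le\|u_{\mu^\#}\|_{L^p}$ for all $1\le p\le\infty$. Moreover, equality holds if and only if the Radon–Nikodym derivative $f$ of $\mu$ equals $f^\#$ a.e. on $(-\pi,\pi)$ and the singular part of $\mu$ is a (nonnegative multiple of a) Dirac mass at the origin, i.e. $\mu=\mu^\#$.
   Context: A ''Borel measure on $(-\pi,\pi)$'' means a positive, non-zero measure on the Borel sets of $(-\pi,\pi)$; $\lambda$ is Lebesgue measure; $L^p$ norms are on $[-\pi,\pi]$. $G(x,y)=-\frac{xy}{2\pi}-\frac12|x-y|+\frac{\pi}{2}$ and $u_\mu(x)=\int G(x,y)\,d\mu(y)$. Decomposition $\mu=\nu+\sigma+\delta$ with $d\nu=f\,d\lambda$, $0\le f\in L^1$, $\sigma\perp\lambda$ atomless, $\delta$ purely discontinuous; singular part $\sigma+\delta$. $f^\#(t)=f^*(2|t|)$ with $f^*(t)=\inf\{s:\lambda(\{f>s\})\le t\}$ ($t\in(0,2\pi)$). Symmetrization: $d\mu^\#=f^\#\,d\lambda+M\,d\delta_0$, $M=\sigma((-\pi,\pi))+\delta((-\pi,\pi))$. *)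

(* Defs.v *)
From HB Require Import structures.
From mathcomp Require Import all_boot all_order all_algebra.
From mathcomp Require Import all_classical all_reals all_analysis.
Set Implicit Arguments. Unset Strict Implicit. Unset Printing Implicit Defensive.
Import Order.TTheory GRing.Theory Num.Theory.
Import numFieldNormedType.Exports.
Local Open Scope classical_set_scope.
Local Open Scope ring_scope.

Definition Ipi {R : realType} : set R := `]- pi, pi[%classic.
Definition Jpi {R : realType} : set R := `[- pi, pi]%classic.

Definition Green {R : realType} (x y : R) : R :=
  - (x * y) / (2 * pi) - `|x - y| / 2 + pi / 2.

Definition u_meas {R : realType} (mu : {measure set R -> \bar R}) (x : R) : R :=
  fine (\int[mu]_(y in Ipi) (Green x y)%:E)%E.

Definition fstar {R : realType} (f : R -> R) (t : R) : R :=
  inf [set s : R | (lebesgue_measure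
          [set x : R | Ipi x /\ (s < f x)%R] <= t%:E)%E].

Definition fsharp {R : realType} (f : R -> R) (t : R) : R :=
  fstar f (2 * `|t|).

(* u_{mu^#}(x) = \int G(x,y) d mu^#(y), with d mu^# = f^# d lambda + M d delta_0,
   written out: \int G(x,y) f^#(y) dy + M G(x,0) *)
Definition u_sharp {R : realType} (f : R -> R) (M : R) (x : R) : R :=
  fine (\int[lebesgue_measure]_(y in Ipi) (Green x y * fsharp f y)%:E)%E
  + M * Green x 0.

(* a function restricted to [-pi,pi] (zero outside), as an extended-real function,
   so that Lnorm w.r.t. Lebesgue measure is the L^p norm on [-pi,pi] *)
Definition onJ {R : realType} (u : R -> R) (x : R) : \bar R :=
  if `[< Jpi x >] then (u x)%:E else 0%E.

(* Main.v *)
(** Let [u = u_mu], [v = u_{mu^#}], [I = (-pi, pi)].  For [a <= b] in [I] put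
    [alpha = pi + a], [beta = pi - b], [r = (b - a) / 2] and
    [kappa = 4 alpha beta / (alpha + beta)^2 <= 1].  The combination
    [beta G(a, .) + alpha G(b, .)] is a trapezoid, constant on [[a, b]]; divided by
    [kappa (alpha + beta)] it has the height of the symmetric trapezoid
    [(G(r, .) + G(-r, .)) / 2], and superlevel sets of the same length.  The
    Hardy-Littlewood inequality therefore gives
      [(beta u(a) + alpha u(b)) / (alpha + beta) <= kappa v(r)],
    so that [u(a), u(b) > t >= 0] forces [v((b - a) / 2) > t].  As [v] is even and
    decreasing in [|x|], the set [{v > t}] is at least as long as the diameter of
    [{u > t}], and the inequality of norms follows from the layer-cake formula.

    With [a = b = x] the same bound reads [u(x) <= (1 - x^2 / pi^2) v(0)].  If
    [u(0) < v(0)], continuity at [0] then gives [sup u < v(0) = max v], which makes the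
    inequality of norms strict for every [p].  So equality forces [u(0) = v(0)], i.e.
    equality in the Hardy-Littlewood inequality against the strictly decreasing weight
    [G(0, .)], and hence [mu = mu^#]. *)
Require Import Defs.
From HB Require Import structures.
From mathcomp Require Import all_boot all_order all_algebra.
From mathcomp Require Import all_classical all_reals all_analysis.
From mathcomp Require Import measurable_realfun ess_sup_inf.
From mathcomp Require Import ring lra.
Import Order.TTheory GRing.Theory Num.Theory.
Import numFieldNormedType.Exports.
Local Open Scope classical_set_scope.
Local Open Scope ring_scope.
Set Implicit Arguments. Unset Strict Implicit. Unset Printing Implicit Defensive.

(** * Layer-cake formula *)

Section LayerCake.
Local Open Scope ereal_scope.
Context d (T : measurableType d) (R : realType).
Variable m : {sigma_finite_measure set T -> \bar R}.
Variables (D : set T) (mD : measurable D).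
Implicit Types f g : T -> R.
Local Notation lam := (@lebesgue_measure R).
Local Notation above f t := (D `&` [set x | (t < f x)%R]).

Lemma measurable_above f t : measurable_fun D f -> measurable (above f t).
Proof.
move=> mf; have := mf mD `]t, +oo[%classic (measurable_itv _).
by congr measurable; apply/seteqP; split => x /=; rewrite in_itv/= andbT.
Qed.

Let GR : measurableType _ := measurableTypeR R.

(** The weight [g] on the region under the graph of [f] over [D]. Restricting to [D] makes it total
    on the product, as Tonelli requires. *)
Let slice f g (z : T * GR) : \bar R :=
  ((\1_[set z : T * GR | D z.1 /\ (0 <= z.2)%R /\ (z.2 < (f \_ D) z.1)%R] z)
   * (g \_ D) z.1)%:E.

Let slice_ge0 f g : (forall x, D x -> (0 <= g x)%R) -> forall z, 0 <= slice f g z.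
Proof.
move=> g0 z; rewrite lee_fin mulr_ge0// patchE.
by case: ifPn => // /set_mem; exact: g0.
Qed.

Let slice_measurable f g : measurable_fun D f -> measurable_fun D g ->
  measurable_fun setT (slice f g).
Proof.
move=> mf mg; apply/measurable_EFinP; apply: measurable_funM.
  apply: measurable_indic.
  have m1 : measurable [set z : T * GR | D z.1].
    have := (@measurable_fst _ _ T (GR)) measurableT D mD.
    by rewrite setTI.
  have h1 : measurable_fun setT (fun z : T * GR => 0 <= z.2)%R.
    exact: measurable_fun_ler.
  have h2 : measurable_fun setT
      (fun z : T * GR => z.2 < (f \_ D) z.1)%R.
    apply: measurable_fun_ltr => //.
    apply: (@measurableT_comp _ _ _ _ _ _ (f \_ D)) => //.
    exact/(measurable_restrictT _ _).1.
  have := measurableI _ _ m1 (measurableI _ _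
    (h1 measurableT [set true] I) (h2 measurableT [set true] I)).
  rewrite !setTI; congr measurable; apply/seteqP; split => z /=; tauto.
apply: (@measurableT_comp _ _ _ _ _ _ (g \_ D)) => //.
exact/(measurable_restrictT _ _).1.
Qed.

Let slice_integral1 f g x : (forall x, D x -> (0 <= f x)%R) ->
  \int[lam]_t slice f g (x, t) = ((fun x => (f x * g x)%:E) \_ D) x.
Proof.
move=> f0; rewrite patchE; case: ifPn => [/[dup] /set_mem Dx xD|xD]; last first.
  apply: integral0_eq => t _; rewrite /slice /= indicE memNset ?mul0r//=.
  by case=> /mem_set; rewrite (negPf xD).
under eq_integral do rewrite /slice /= !patchE xD EFinM.
transitivity (\int[lam]_t ((\1_`[0%R, f x[%classic t)%:E * (g x)%:E)).
  apply: eq_integral => t _; congr (_%:E * _); rewrite !indicE; congr (nat_of_bool _)%:R.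
  apply/idP/idP => /set_mem h; apply/mem_set.
    by case: h => _ /= []; rewrite patchE xD in_itv/= => -> ->.
  by move: h => /=; rewrite in_itv/= patchE xD => /andP[].
rewrite integralZr//=; last first.
  exact: integrable_indic_itv.
rewrite integral_indic// setIT.
rewrite /= lebesgue_measure_itv/= lte_fin.
rewrite EFinM; congr (_ * _); case: ltP => [|fx0]; first by rewrite oppr0 adde0.
by congr EFin; apply/le_anti/andP; split => //; exact: f0.
Qed.

Let slice_integral2 f g (t : R) : measurable_fun D f -> (0 <= t)%R ->
  \int[m]_x slice f g (x, t) = \int[m]_(x in above f t) (g x)%:E.
Proof.
move=> mf t0; rewrite [RHS]integral_mkcond; apply: eq_integral => x _.
rewrite /slice /= indicE !patchE.
have [xD|xD] := boolP (x \in D); last first.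
  rewrite mulr0 memNset//; case=> /mem_set; by rewrite (negPf xD).
have [tf|tf] := ltP t (f x).
  rewrite !mem_set ?mul1r//=; first by split => //; exact/set_mem.
  by split; [exact/set_mem|split => //; rewrite patchE xD].
rewrite !memNset ?mul0r//=; first by case=> _; rewrite ltNge tf.
by case=> _ [_]; rewrite patchE xD ltNge tf.
Qed.

(** For [t >= 0] this is the inner Tonelli integral of [slice], which is measurable in [t]; for
    [t < 0] the slice is zero, hence the restriction to [[0, +oo[]. *)
Lemma measurable_integral_above f g : measurable_fun D f -> measurable_fun D g ->
  (forall x, D x -> (0 <= g x)%R) ->
  measurable_fun (`[0%R, +oo[%classic : set R) (fun t => \int[m]_(x in above f t) (g x)%:E).
Proof.
move=> mf mg g0.
apply: (eq_measurable_fun (fun t => \int[m]_x slice f g (x, t))).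
  by move=> t /set_mem/=; rewrite in_itv/= andbT => t0; exact: slice_integral2.
apply: measurable_funTS.
have := (measurable_fun_fubini_tonelli_G (m1 := m) (slice f g)
  (slice_measurable mf mg) (slice_ge0 f g0)).
rewrite /fubini_G.
exact.
Qed.

(** Tonelli for [slice]: integrating first in [t] gives [f x * g x], first in [x] the integral of
    [g] over a superlevel set of [f]. *)
Lemma layer_cake f g : measurable_fun D f -> measurable_fun D g ->
  (forall x, D x -> (0 <= f x)%R) -> (forall x, D x -> (0 <= g x)%R) ->
  \int[m]_(x in D) (f x * g x)%:E =
  \int[lam]_(t in `[0%R, +oo[) \int[m]_(x in above f t) (g x)%:E.
Proof.
move=> mf mg f0 g0; rewrite integral_mkcond.
under eq_integral do rewrite -slice_integral1//.
rewrite (fubini_tonelli (slice f g))//; [|exact: slice_measurable|exact: slice_ge0].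
rewrite [RHS]integral_mkcond; apply: eq_integral => t _; rewrite patchE.
case: ifPn => [/set_mem/=|tN].
  by rewrite in_itv/= andbT => t0; exact: slice_integral2.
apply: integral0_eq => x _; rewrite /slice/= indicE memNset ?mul0r//=.
by case=> _ [t0 _]; move/negP: tN; apply; apply/mem_set; rewrite /= in_itv/= t0.
Qed.

Lemma layer_cake1 f : measurable_fun D f -> (forall x, D x -> (0 <= f x)%R) ->
  \int[m]_(x in D) (f x)%:E = \int[lam]_(t in `[0%R, +oo[) m (above f t).
Proof.
move=> mf f0; under eq_integral do rewrite -[f _]mulr1.
rewrite (@layer_cake f (cst 1%R))//; apply: eq_integral => t _ /=.
by rewrite integral_cst ?mul1e//; exact: measurable_above.
Qed.

Lemma measurable_measure_above f : measurable_fun D f ->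
  measurable_fun (`[0%R, +oo[%classic : set R) (fun t => m (above f t)).
Proof.
move=> mf.
have := @measurable_integral_above f (cst 1%R) mf (measurable_cst _) (fun _ _ => ler01).
apply: eq_measurable_fun => t _ /=.
by rewrite integral_cst ?mul1e//; exact: measurable_above.
Qed.

End LayerCake.

(** * Rearrangement inequalities *)

(** The difference [g - f] is nonnegative, and finiteness of the integrals lets them be subtracted,
    so its integral is zero. *)
Lemma ae_eq_of_le_integral d (T : measurableType d) (R : realType)
    (m : {measure set T -> \bar R}) (D : set T) (f g : T -> \bar R) :
  measurable D -> measurable_fun D f -> measurable_fun D g ->
  (forall x, D x -> (0 <= f x)%E) -> (forall x, D x -> (f x <= g x)%E) ->
  (forall x, D x -> g x \is a fin_num) ->
  (\int[m]_(x in D) g x < +oo)%E ->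
  (\int[m]_(x in D) f x = \int[m]_(x in D) g x)%E ->
  {ae m, forall x, D x -> f x = g x}.
Proof.
move=> mD mf mg f0 fg gfin goo fgE.
have ffin x : D x -> f x \is a fin_num.
  move=> Dx; rewrite ge0_fin_numE ?f0//.
  by rewrite (le_lt_trans (fg _ Dx))// ltey_eq gfin.
have g0 x : D x -> (0 <= g x)%E by move=> Dx; rewrite (le_trans (f0 _ Dx)) ?fg.
have ig : m.-integrable D g.
  apply/integrableP; split=> //; rewrite (eq_integral g)// => x /set_mem Dx.
  by rewrite gee0_abs ?g0.
have if_ : m.-integrable D f.
  apply/integrableP; split=> //; rewrite (eq_integral f) ?fgE// => x /set_mem Dx.
  by rewrite gee0_abs ?f0.
have : (\int[m]_(x in D) `|(g \- f) x| = 0)%E.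
  rewrite (eq_integral (g \- f)%E); last first.
    by move=> x /set_mem Dx; rewrite gee0_abs// sube_ge0 ?fg ?gfin ?orbT ?ffin.
  rewrite integralB// fgE subee//.
  exact: integrable_fin_num.
move/ae_eq_integral_abs => /(_ mD (emeasurable_funB mg mf)).
apply: filterS => x /= h Dx; have /= /eqP := h Dx.
by rewrite sube_eq ?gfin ?ffin//= ?fin_num_adde_defl ?ffin// add0e => /eqP.
Qed.

Section Rearrangement.
Local Open Scope ereal_scope.
Context d (T : measurableType d) (R : realType).
Variable m : {sigma_finite_measure set T -> \bar R}.
Variables (D : set T) (mD : measurable D).
Implicit Types (f g h F G : T -> R) (s t : R).
Local Notation lam := (@lebesgue_measure R).
Local Notation above f t := (D `&` [set x | (t < f x)%R]).

(** By layer cake it suffices that [m (A & {g > s}) <= min (m A) (m {g > s}) <= min (m B) (m {G >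
    s}) = m (B & {G > s})]; the last equality is the nesting of [B] and [{G > s}]. *)
Lemma le_integral_nested (A B : set T) g G :
  measurable A -> measurable B -> A `<=` D -> B `<=` D ->
  measurable_fun D g -> measurable_fun D G ->
  (forall x, D x -> (0 <= g x)%R) -> (forall x, D x -> (0 <= G x)%R) ->
  m A <= m B ->
  (forall s, (0 <= s)%R -> m (above g s) <= m (above G s)) ->
  (forall s, (0 <= s)%R -> B `<=` above G s \/ above G s `<=` B) ->
  \int[m]_(x in A) (g x)%:E <= \int[m]_(x in B) (G x)%:E.
Proof.
move=> mA mB AD BD mg mG g0 G0 AB gG nested.
have mgA : measurable_fun A g by exact: measurable_funS mg.
have mGB : measurable_fun B G by exact: measurable_funS mG.
rewrite !layer_cake1//; [|by move=> x /BD; exact: G0|by move=> x /AD; exact: g0].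
apply: ge0_le_integral => //; [exact: measurable_measure_above|
  exact: measurable_measure_above|].
move=> s /=; rewrite in_itv/= andbT => s0.
have mGs : measurable (above G s) by exact: measurable_above.
have mgs : measurable (above g s) by exact: measurable_above.
have mAs := measurable_above mA s mgA; have mBs := measurable_above mB s mGB.
have [BG|GB] := nested _ s0.
  apply: (@le_trans _ _ (m A)); first by apply: le_measure; rewrite ?inE//; exact: subIsetl.
  apply: (le_trans AB); apply: le_measure; rewrite ?inE// => x Bx.
  by split => //; have [] := BG _ Bx.
apply: (@le_trans _ _ (m (above g s))).
  by apply: le_measure; rewrite ?inE// => x [/AD].
apply: (le_trans (gG _ s0)); apply: le_measure; rewrite ?inE// => x [Dx sx].
by split => //; exact: GB.
Qed.

(** Layer cake in the first factor, then [le_integral_nested] at each level. Only inequalities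
    between distribution functions and nested superlevel sets are asked for, so [F] and [G] can be
    any symmetric competitors. *)
Lemma hardy_littlewood f g F G :
  measurable_fun D f -> measurable_fun D g ->
  measurable_fun D F -> measurable_fun D G ->
  (forall x, D x -> (0 <= f x)%R) -> (forall x, D x -> (0 <= g x)%R) ->
  (forall x, D x -> (0 <= F x)%R) -> (forall x, D x -> (0 <= G x)%R) ->
  (forall t, (0 <= t)%R -> m (above f t) <= m (above F t)) ->
  (forall s, (0 <= s)%R -> m (above g s) <= m (above G s)) ->
  (forall t s, (0 <= t)%R -> (0 <= s)%R ->
     above F t `<=` above G s \/ above G s `<=` above F t) ->
  \int[m]_(x in D) (f x * g x)%:E <= \int[m]_(x in D) (F x * G x)%:E.
Proof.
move=> mf mg mF mG f0 g0 F0 G0 fF gG nested.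
rewrite !layer_cake//; apply: ge0_le_integral => //.
- move=> t /=; rewrite in_itv/= andbT => t0.
  by apply: integral_ge0 => x [Dx _]; rewrite lee_fin g0.
- exact: measurable_integral_above.
- exact: measurable_integral_above.
- move=> t /=; rewrite in_itv/= andbT => t0.
  apply: le_integral_nested => //.
  + exact: measurable_above.
  + exact: measurable_above.
  + exact: fF.
  by move=> s s0; exact: nested.
Qed.

(* [(1_B - 1_A) (g - c)] is nonnegative with zero integral, and positive on [B \ A]. *)
Lemma bathtub_rigidity (A B : set T) g (c : R) :
  measurable A -> measurable B -> A `<=` D -> B = D `&` [set x | (c < g x)%R] ->
  m.-integrable D (EFin \o g) -> m A = m B -> m B < +oo ->
  \int[m]_(x in A) (g x)%:E = \int[m]_(x in B) (g x)%:E ->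
  m (A `|` B) = m B.
Proof.
move=> mA mB AD BE ig AB Boo gAB.
have BD : B `<=` D by rewrite BE; exact: subIsetl.
have icst C : measurable C -> m C < +oo -> m.-integrable C (EFin \o cst c).
  move=> mC Coo; apply: measurable_bounded_integrable => //.
  exists `|c|%R; split; first exact: num_real.
  by move=> x cx y _ /=; exact: ltW.
pose q x : \bar R := (g x - c)%:E.
have iq C : measurable C -> C `<=` D -> m C < +oo -> m.-integrable C q.
  move=> mC CD Coo; have igC : m.-integrable C (EFin \o g) by exact: integrableS ig.
  exact: (integrableB mC igC (icst _ mC Coo)).
have qE C : measurable C -> C `<=` D -> m C < +oo ->
    \int[m]_(x in C) q x = \int[m]_(x in C) (g x)%:E - c%:E * m C.
  move=> mC CD Coo; rewrite -(integral_cst m mC).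
  have igC : m.-integrable C (EFin \o g) by exact: integrableS ig.
  exact: (integralB_EFin mC igC (icst _ mC Coo)).
have Aoo : m A < +oo by rewrite AB.
have qAB : \int[m]_(x in A) q x = \int[m]_(x in B) q x.
  by rewrite !qE// AB gAB.
have iqA : m.-integrable D (q \_ A).
  have := (integrable_mkcond q mA).1 (iq _ mA AD Aoo).
  by apply: integrableS.
have iqB : m.-integrable D (q \_ B).
  have := (integrable_mkcond q mB).1 (iq _ mB BD Boo).
  by apply: integrableS.
have : \int[m]_(x in D) `|((q \_ B) \- (q \_ A)) x| = 0.
  rewrite (eq_integral ((q \_ B) \- (q \_ A))); last first.
    move=> x /set_mem Dx; rewrite gee0_abs//= !patchE.
    case: ifPn => xB; case: ifPn => xA; rewrite ?sube0 ?subee ?sub0e//.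
      by rewrite /q lee_fin subr_ge0; move: (set_mem xB); rewrite BE => -[_ /ltW].
    rewrite -EFinN lee_fin opprB subr_ge0 leNgt; apply/negP => cg.
    by move/negP: xB; apply; apply/mem_set; rewrite BE.
  rewrite integralB// -!integral_mkcondr !(setIidr, setIidl)// qAB subee//.
  exact: integrable_fin_num (iq _ mB BD Boo).
have mqAB : measurable_fun D ((q \_ B) \- (q \_ A)).
  by apply: emeasurable_funB; [exact: measurable_int iqB|exact: measurable_int iqA].
move/(ae_eq_integral_abs _ mD mqAB) => [N [mN N0 DN]].
(* On [B] minus [A] the integrand equals [g - c > 0], so this set lies in the exceptional null
   set. *)
have BA0 : m (B `\` A) = 0.
  apply: (subset_measure0 _ mN _ N0); first exact: measurableD.
  move=> x [Bx Ax]; apply: DN => /= /(_ (BD _ Bx)).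
  rewrite !patchE mem_set// memNset// sube0 /q => -[] /eqP; rewrite subr_eq0.
  by move: Bx; rewrite BE => -[_ /= cg] /eqP gc; rewrite gc ltxx in cg.
have -> : A `|` B = A `|` (B `\` A) by rewrite setUDr setDv setD0.
by rewrite measureU0//; exact: measurableD.
Qed.

(** Equality of the products forces, at almost every level, equality of the integrals of [g] over
    [{f > t}] and [{F > t}]. As [{F > t}] is also a superlevel set of [g], [bathtub_rigidity]
    identifies the two sets up to null sets. *)
Lemma rearrangement_rigidity f F g :
  measurable_fun D f -> measurable_fun D F -> measurable_fun D g ->
  (forall x, D x -> (0 <= f x)%R) -> (forall x, D x -> (0 <= F x)%R) ->
  (forall x, D x -> (0 <= g x)%R) ->
  m D < +oo -> m.-integrable D (EFin \o g) -> m.-integrable D (EFin \o F) ->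
  (forall t, (0 <= t)%R -> m (above f t) = m (above F t)) ->
  (forall t, (0 <= t)%R -> exists c : R, above F t = above g c) ->
  \int[m]_(x in D) (F x * g x)%:E < +oo ->
  \int[m]_(x in D) (f x * g x)%:E = \int[m]_(x in D) (F x * g x)%:E ->
  {ae m, forall x, D x -> f x = F x}.
Proof.
move=> mf mF mg f0 F0 g0 Doo ig iF fF Fg Fgoo fgE.
have gDoo C : measurable C -> C `<=` D -> \int[m]_(x in C) (g x)%:E \is a fin_num.
  by move=> mC CD; apply: integrable_fin_num => //; exact: integrableS ig.
have mab h t : measurable_fun D h -> measurable (above h t).
  exact: measurable_above.
have sub h t : above h t `<=` D by exact: subIsetl.
have FD t : m (above F t) < +oo.
  by apply: le_lt_trans Doo; apply: le_measure; rewrite ?inE//; exact: mab.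
have Hae : {ae lam, forall t, `[0%R, +oo[%classic t ->
    \int[m]_(x in above f t) (g x)%:E = \int[m]_(x in above F t) (g x)%:E}.
  apply: ae_eq_of_le_integral => //.
  - exact: measurable_integral_above.
  - exact: measurable_integral_above.
  - by move=> t _; apply: integral_ge0 => x [Dx _]; rewrite lee_fin g0.
  - move=> t /=; rewrite in_itv/= andbT => t0.
    apply: le_integral_nested => //; [exact: mab|exact: mab|by rewrite fF|].
    move=> s _; have [c ->] := Fg _ t0.
    have [cs|sc] := leP c s; [right|left] => x [Dx /= gx]; split => //=.
      exact: le_lt_trans gx.
    exact: lt_trans gx.
  - by move=> t _; apply: gDoo; [exact: mab|exact: sub].
  - by rewrite -layer_cake.
  - by rewrite -!layer_cake.
(* The maximum turns coincidence of level sets for almost every [t] into coincidence of functions: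
   [h] dominates [f] and [F] and has the same integral as both, so both equal [h] almost
   everywhere. *)
pose h x := Num.max (f x) (F x).
have mh : measurable_fun D h by exact: measurable_maxr.
have h0 x : D x -> (0 <= h x)%R by move=> Dx; rewrite le_max f0.
have hE t : above h t = above f t `|` above F t.
  apply/seteqP; split => x /=; rewrite lt_max.
    by case=> Dx /orP[]; [left|right].
  by case=> -[Dx ->]; rewrite ?orbT.
have fE : \int[m]_(x in D) (f x)%:E = \int[m]_(x in D) (F x)%:E.
  rewrite !layer_cake1//; apply: eq_integral => t /set_mem/=.
  by rewrite in_itv/= andbT => t0; exact: fF.
have hFE : \int[m]_(x in D) (h x)%:E = \int[m]_(x in D) (F x)%:E.
  rewrite !layer_cake1//; apply: ae_eq_integral => //.
  - exact: measurable_measure_above.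
  - exact: measurable_measure_above.
  - have [N [mN N0 DN]] := Hae; exists N; split => // t /=.
    apply: contra_notP => Nt It; rewrite hE.
    have Ht : `[0%R, +oo[%classic t -> \int[m]_(x in above f t) (g x)%:E =
        \int[m]_(x in above F t) (g x)%:E by apply: contrapT => /DN.
    have t0 : (0 <= t)%R by move: It; rewrite /= in_itv/= andbT.
    have [c FgE] := Fg _ t0.
    apply: (bathtub_rigidity (g := g) (c := c)) => //; [exact: mab|exact: mab|exact: fF|].
    exact: Ht.
have Foo : \int[m]_(x in D) (F x)%:E < +oo.
  by rewrite ltey_eq integrable_fin_num.
have hoo : \int[m]_(x in D) (h x)%:E < +oo by rewrite hFE.
have mE k : measurable_fun D k -> measurable_fun D (EFin \o k) by move=> ?; exact/measurable_EFinP.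
have fh : {ae m, forall x, D x -> (f x)%:E = (h x)%:E}.
  apply: ae_eq_of_le_integral => //; [exact: mE|exact: mE|..|by rewrite hFE].
  by move=> x _; rewrite lee_fin le_max lexx.
have Fh : {ae m, forall x, D x -> (F x)%:E = (h x)%:E}.
  apply: ae_eq_of_le_integral => //; [exact: mE|exact: mE|].
  by move=> x _; rewrite lee_fin le_max lexx orbT.
near=> x => Dx.
have fx : (f x)%:E = (h x)%:E by apply: (near fh x).
have Fx : (F x)%:E = (h x)%:E by apply: (near Fh x).
by apply: EFin_inj; rewrite fx Fx.
Unshelve. all: by end_near. Qed.

End Rearrangement.

(** * Decreasing rearrangement *)

(* Removing the origin avoids the junk value of [fsharp f 0] for essentially unbounded [f]. *)
Definition Ipi0 {R : realType} : set R := Ipi `\ 0.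

Section DecreasingRearrangement.
Context {R : realType}.
Implicit Types (f : R -> R) (s t x y r c : R).
Local Notation lam := (@lebesgue_measure R).
Local Notation levelset f s := [set x | Ipi x /\ (s < f x)%R].

Lemma measurable_Ipi : measurable (Ipi : set R).
Proof. exact: measurable_itv. Qed.

Lemma measurable_Ipi0 : measurable (Ipi0 : set R).
Proof. by apply: measurableD => //; exact: measurable_Ipi. Qed.

Lemma Ipi0_sub : (Ipi0 : set R) `<=` Ipi.
Proof. by move=> x []. Qed.

Lemma IpiP x : Ipi x <-> `|x| < pi.
Proof. by rewrite /Ipi /= in_itv/= ltr_norml. Qed.

Lemma Ipi_zero : Ipi (0 : R).
Proof. by apply/IpiP; rewrite normr0 pi_gt0. Qed.

Lemma Ipi0P x : Ipi0 x <-> 0 < `|x| < pi.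
Proof.
rewrite /Ipi0 normr_gt0; split=> [[/IpiP -> /eqP ->]//|/andP[/eqP x0 xpi]].
by split => //; apply/IpiP.
Qed.

Lemma lebesgue_Ipi : lam Ipi = (2 * pi)%:E.
Proof.
rewrite /Ipi lebesgue_measure_itv/= lte_fin gtrN ?pi_gt0//.
by rewrite -EFinD opprK mulr_natl mulr2n.
Qed.

Lemma lebesgue_setD1 (A : set R) x : measurable A -> lam (A `\ x) = lam A.
Proof.
move=> mA; have mx : measurable [set x] by exact: measurable_set1.
have mAx : measurable (A `&` [set x]) by exact: measurableI.
rewrite (measureDI lam mA mx) [X in (_ + X)%E](_ : _ = 0%E) ?adde0//.
by apply: (subset_measure0 (mu := lam) mAx mx) => //; exact: lebesgue_measure_set1.
Qed.

(** Superlevel sets of [fsharp f] and of the symmetric trapezoid both take this form, a centred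
    interval of length [c] without its midpoint. *)
Lemma lebesgue_Ipi0_centered c : 0 <= c <= 2 * pi ->
  lam (Ipi0 `&` [set x | 2 * `|x| < c]) = c%:E.
Proof.
move=> /andP[c0 c2pi].
have -> : Ipi0 `&` [set x | 2 * `|x| < c] = `](- (c / 2)), (c / 2)[%classic `\ 0.
  apply/seteqP; split=> x /=; rewrite in_itv/= -ltr_norml ltr_pdivlMr// mulrC.
    by case=> -[_ x0] ->.
  by case=> xc x0; split => //; apply/Ipi0P; rewrite normr_gt0; apply/andP; split;
    [exact/eqP|lra].
rewrite lebesgue_setD1//= lebesgue_measure_itv/= lte_fin.
have [cc|cc] := ltP; first by rewrite -EFinD; congr EFin; lra.
by congr EFin; lra.
Qed.

Lemma measurable_Ipi0_centered c :
  measurable (Ipi0 `&` [set x : R | 2 * `|x| < c]).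
Proof.
apply: measurableI; first exact: measurable_Ipi0.
rewrite (_ : [set _ | _] = `](- (c / 2)), (c / 2)[%classic)//.
by apply/seteqP; split=> x /=; rewrite in_itv/= -ltr_norml ltr_pdivlMr// mulrC.
Qed.

(** * Distribution function of [f] and superlevel sets of [fsharp f] *)

Section fixed_function.
Variable f : R -> R.
Hypothesis f_ge0 : forall x, Ipi x -> 0 <= f x.
Hypothesis f_int : lam.-integrable Ipi (EFin \o f).

Lemma levelset_measurable s : measurable (levelset f s).
Proof.
apply: (@measurable_above _ _ _ _ measurable_Ipi f s).
apply/measurable_EFinP; exact: measurable_int f_int.
Qed.

Lemma levelset_le s : (lam (levelset f s) <= (2 * pi)%:E)%E.
Proof.
rewrite -lebesgue_Ipi; apply: le_measure; rewrite ?inE.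
- exact: levelset_measurable.
- exact: measurable_Ipi.
- by move=> x [].
Qed.

Lemma levelset_fin s : lam (levelset f s) \is a fin_num.
Proof. by rewrite ge0_fin_numE// (le_lt_trans (levelset_le s))// ltry. Qed.

Lemma levelset_nonincreasing s t : s <= t ->
  (lam (levelset f t) <= lam (levelset f s))%E.
Proof.
move=> st; apply: le_measure; rewrite ?inE.
- exact: levelset_measurable.
- exact: levelset_measurable.
- by move=> x [? tf]; split => //; exact: le_lt_trans tf.
Qed.

Lemma levelset_neg s : s < 0 -> lam (levelset f s) = (2 * pi)%:E.
Proof.
move=> s0; rewrite -lebesgue_Ipi; congr lebesgue_measure.
apply/seteqP; split => [x []//|x Ix]; split => //.
by apply: lt_le_trans (f_ge0 _).
Qed.

(** Markov's inequality. It shows that the set whose infimum is [fstar f t] is nonempty for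
    [t > 0]. *)
Lemma levelset_small t : 0 < t -> exists s, (lam (levelset f s) <= t%:E)%E.
Proof.
move=> t0; have [mf foo] := integrableP _ _ _ f_int.
pose K := (\int[lam]_(x in Ipi) `|(EFin \o f) x|)%E.
have K0 : (0 <= K)%E by exact: integral_ge0.
have Kfin : K \is a fin_num by rewrite ge0_fin_numE.
(* Any [s > 0] with [K <= s * t] works; the [+ 1] keeps [s] positive when [K = 0]. *)
pose s := (fine K / t + 1).
have s0 : 0 < s by rewrite ltr_wpDl// divr_ge0 ?fine_ge0// ltW.
exists s; have /= := le_integral_abse lam measurable_Ipi mf s0.
rewrite -/K -(fineK Kfin) => sK.
have mA : measurable (Ipi `&` [set x | (s%:E <= `|(EFin \o f) x|)%E]).
  by apply: emeasurable_fun_c_infty; [exact: measurable_Ipi|exact: measurableT_comp].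
apply: (@le_trans _ _ (lam (Ipi `&` [set x | (s%:E <= `|(EFin \o f) x|)%E]))).
  apply: le_measure; rewrite ?inE//; first exact: levelset_measurable.
  move=> x [Ix sf]; split => //=; rewrite lee_fin (le_trans (ltW sf))//.
  exact: ler_norm.
rewrite -(@lee_pmul2l _ s%:E) ?lte_fin//.
apply: (le_trans sK); rewrite -EFinM lee_fin /s mulrDl mul1r divfK ?gt_eqF//.
by rewrite lerDl ltW.
Qed.

(** Right continuity of the distribution function: [{f > s}] is the increasing union of the sets
    [{f > s + 1 / (n + 1)}]. *)
Lemma levelset_right_cont s t :
  (forall e, 0 < e -> (lam (levelset f (s + e)) <= t%:E)%E) ->
  (lam (levelset f s) <= t%:E)%E.
Proof.
move=> h; pose F n := levelset f (s + n.+1%:R^-1).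
have FE : levelset f s = \bigcup_n F n.
  apply/seteqP; split => x; last first.
    move=> [n _ [Ix sf]]; split => //; apply: lt_trans sf.
    by rewrite ltrDl invr_gt0.
  move=> [Ix sf]; have [n nf] := ltr_add_invr sf.
  by exists n.
have mF n : measurable (F n) by exact: levelset_measurable.
have ndF : nondecreasing_seq F.
  move=> i j ij; apply/subsetPset => x [Ix sf]; split => //.
  by apply: le_lt_trans sf; rewrite lerD2l lef_pV2 ?posrE// ler_nat ltnS.
rewrite FE.
have mUF : measurable (\bigcup_n F n) by exact: bigcup_measurable.
have cF := @nondecreasing_cvg_mu _ _ _ lam _ mF mUF ndF.
rewrite -(cvg_lim _ cF)//; apply: lime_le; first exact: cvgP cF.
by apply: nearW => n /=; apply: h; rewrite invr_gt0.
Qed.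

(** The set defining [fstar f t] is a closed half-line, by monotonicity and right continuity. It is
    nonempty since [t > 0], and bounded below since [t < 2 * pi] excludes negative [s]; so [inf] is
    a genuine minimum. *)
Lemma fstar_gt s t : 0 < t < 2 * pi ->
  (s < fstar f t)%R = (t%:E < lam (levelset f s))%E.
Proof.
move=> /andP[t0 t2pi]; pose S := [set s | (lam (levelset f s) <= t%:E)%E].
have S0 : S !=set0 by exact: levelset_small.
have Slb : has_lbound S.
  exists 0 => r Sr; rewrite leNgt; apply/negP => r0; move: Sr.
  by rewrite /S/= levelset_neg// lee_fin leNgt t2pi.
rewrite /fstar -/S; apply/idP/idP => [sS|].
  rewrite ltNge; apply/negP => sS'; move: sS; rewrite ltNge => /negP; apply.
  exact: ge_inf.
rewrite !ltNge; apply: contra => Ss; apply: levelset_right_cont => e e0.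
have sse : inf S < s + e by rewrite (le_lt_trans Ss)// ltrDl.
have [r Sr rse] := inf_lt S0 sse.
by apply: le_trans Sr; exact/levelset_nonincreasing/ltW.
Qed.

Lemma fsharp_gt s x : Ipi0 x ->
  (s < fsharp f x)%R = ((2 * `|x|)%:E < lam (levelset f s))%E.
Proof.
by move/Ipi0P => /andP[x0 xpi]; rewrite /fsharp fstar_gt// mulr_gt0//= ltr_pM2l.
Qed.

Lemma fsharp_above s : Ipi0 `&` [set x | s < fsharp f x] =
  Ipi0 `&` [set x | 2 * `|x| < fine (lam (levelset f s))].
Proof.
by apply/seteqP; split => x [Ix /=]; rewrite fsharp_gt// -(fineK (levelset_fin s))
  lte_fin.
Qed.

Lemma fsharp_above_measure s :
  lam (Ipi0 `&` [set x | s < fsharp f x]) = lam (levelset f s).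
Proof.
rewrite fsharp_above lebesgue_Ipi0_centered ?fineK ?levelset_fin//.
by rewrite fine_ge0//= -lee_fin fineK ?levelset_fin// levelset_le.
Qed.

Lemma above_Ipi0_measure s : lam (Ipi0 `&` [set x | s < f x]) = lam (levelset f s).
Proof.
rewrite -(lebesgue_setD1 0 (levelset_measurable s)); congr lebesgue_measure.
by apply/seteqP; split => x /=; rewrite /Ipi0/=; tauto.
Qed.

Lemma fsharp_ge0 x : Ipi0 x -> 0 <= fsharp f x.
Proof.
move=> Ix; rewrite leNgt; apply/negP => fx0.
have := fsharp_gt (fsharp f x) Ix; rewrite ltxx levelset_neg// lte_fin ltr_pM2l//.
by have /Ipi0P/andP[_ ->] := Ix.
Qed.

Lemma measurable_fsharp : measurable_fun Ipi0 (fsharp f).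
Proof.
move=> mD; apply: (measurability _ (RGenOInfty.measurableE R)) => //.
move=> _ [_ [s ->] <-].
rewrite [X in measurable X](_ : _ = Ipi0 `&` [set x | s < fsharp f x]); last first.
  by apply/seteqP; split => x /=; rewrite in_itv/= andbT.
rewrite fsharp_above; exact: measurable_Ipi0_centered.
Qed.

End fixed_function.
End DecreasingRearrangement.

(** * Green function and trapezoids *)

Section GreenFunction.
Context {R : realType}.
Implicit Types (x y a b r : R).

Let pi0 : 0 < (pi : R) := pi_gt0 R.

(** As a minimum of two products the kernel is visibly nonnegative on the square, and keeping either
    product bounds it above. *)
Lemma Green_minE x y : Green x y =
  Num.min ((pi + y) * (pi - x)) ((pi - y) * (pi + x)) / (2 * pi).
Proof.
rewrite /Green; move: pi0; generalize (pi : R) => p p0.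
have pn0 : p != 0 by rewrite gt_eqF.
have [xy|xy] := leP x y.
  rewrite ler0_norm ?subr_le0// min_r; first by field.
  rewrite -subr_ge0; have : 0 <= p * (y - x) by rewrite mulr_ge0 ?subr_ge0 ?(ltW p0).
  by lra.
rewrite gtr0_norm ?subr_gt0// min_l; first by field.
rewrite -subr_ge0; have : 0 < p * (x - y) by rewrite mulr_gt0 ?subr_gt0.
by lra.
Qed.

Lemma Green_le1 x y : Green x y <= (pi + y) * (pi - x) / (2 * pi).
Proof. by rewrite Green_minE ler_pM2r ?invr_gt0 ?mulr_gt0// ge_min lexx. Qed.

Lemma Green_le2 x y : Green x y <= (pi - y) * (pi + x) / (2 * pi).
Proof. by rewrite Green_minE ler_pM2r ?invr_gt0 ?mulr_gt0// ge_min lexx orbT. Qed.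

Lemma Green_ge0 x y : `|x| <= pi -> `|y| <= pi -> 0 <= Green x y.
Proof.
rewrite !ler_norml => /andP[x1 x2] /andP[y1 y2].
rewrite Green_minE; apply: divr_ge0; last by rewrite mulr_ge0// ltW.
by rewrite le_min !mulr_ge0//; lra.
Qed.

(** The bilinear terms cancel and [|x - y| + |x + y| = 2 max(|x|, |y|)]. Averaging over the
    reflection thus yields the symmetric trapezoid. *)
Lemma Green_sym x y : Green x y + Green x (- y) = pi - Num.max `|x| `|y|.
Proof.
rewrite /Green opprK.
suff H : `|x - y| + `|x + y| = 2 * Num.max `|x| `|y|.
  transitivity (pi - (`|x - y| + `|x + y|) / 2).
    by move: pi0; generalize (pi : R) => p p0; field; rewrite gt_eqF.
  by rewrite H mulrC mulKf.
rewrite /Num.max.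
by case: (ger0P (x - y)) => h1; case: (ger0P (x + y)) => h2;
  case: (ger0P x) => hx; case: (ger0P y) => hy; case: ltP => h3; lra.
Qed.

Lemma Green0 x : Green x 0 = (pi - `|x|) / 2.
Proof. by rewrite /Green subr0 mulr0 oppr0 mul0r; lra. Qed.

Lemma Green0l y : Green 0 y = (pi - `|y|) / 2.
Proof. by rewrite /Green sub0r normrN mul0r oppr0 mul0r; lra. Qed.

(** The bilinear term has slope at most [1 / 2] because [|y| <= pi], and the absolute value
    contributes another half. *)
Lemma Green_lipschitz x x' y : `|y| <= pi -> `|Green x y - Green x' y| <= `|x - x'|.
Proof.
move=> ypi.
have -> : Green x y - Green x' y =
    - ((x - x') * (y / (2 * pi))) - (`|x - y| - `|x' - y|) / 2.
  rewrite /Green; move: pi0; generalize (pi : R) => p p0.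
  by field; rewrite gt_eqF.
apply: (le_trans (ler_normB _ _)); rewrite normrN normrM.
have h1 : `|y / (2 * pi)| <= 1 / 2.
  rewrite normrM normfV [`|2 * pi|]gtr0_norm ?mulr_gt0//.
  by rewrite ler_pdivrMr ?mulr_gt0//; lra.
have h2 : `|(`|x - y| - `|x' - y|) / 2| <= `|x - x'| / 2.
  rewrite normrM [`|2^-1|]gtr0_norm// ler_pM2r//.
  apply: (le_trans (ler_dist_dist _ _)).
  by rewrite opprB addrA subrK.
have h3 : `|x - x'| * `|y / (2 * pi)| <= `|x - x'| * (1 / 2) by rewrite ler_wpM2l.
by apply: (le_trans (lerD h3 h2)); lra.
Qed.

Lemma Green_le x y : `|y| <= pi -> `|Green x y| <= `|x| + pi.
Proof.
move=> ypi; have := Green_lipschitz x 0 ypi; rewrite subr0 Green0l => h.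
have -> : Green x y = (Green x y - (pi - `|y|) / 2) + (pi - `|y|) / 2 by ring.
apply: (le_trans (ler_normD _ _)); apply: lerD => //.
have y0 := normr_ge0 y.
by rewrite (ger0_norm (x := (pi - _) / 2)) ?divr_ge0 ?subr_ge0//; move: pi0; lra.
Qed.

Lemma measurable_Green D x : measurable_fun D (Green x).
Proof.
apply: measurable_funTS; rewrite /Green; apply: measurable_funD => //.
apply: measurable_funB.
  apply: measurable_funM => //.
  by apply: measurable_funN; apply: measurable_funM.
apply: measurable_funM => //.
apply: measurableT_comp => //.
by apply: measurable_funB.
Qed.

(* The scaling gives height [((pi + a) + (pi - b)) / 4], that of
   [sym_trapezoid ((b - a) / 2)], whatever the centre of [[a, b]]. *)
Definition trapezoid a b y : R :=
  ((pi - b) * Green a y + (pi + a) * Green b y) *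
  ((pi + a) + (pi - b)) / (4 * (pi + a) * (pi - b)).

(** This is [(Green r y + Green r (- y)) / 2]: flat for [|y| <= |r|], with slopes of modulus [1 / 2]
    outside. *)
Definition sym_trapezoid r y : R := (pi - Num.max `|r| `|y|) / 2.

Lemma trapezoid_ge0 a b y : Ipi a -> Ipi b -> Ipi y -> 0 <= trapezoid a b y.
Proof.
move=> /IpiP ha /IpiP hb /IpiP hy.
have ga := Green_ge0 (ltW ha) (ltW hy); have gb := Green_ge0 (ltW hb) (ltW hy).
move: ha hb; rewrite !ltr_norml => /andP[a1 a2] /andP[b1 b2].
have h1 : 0 < pi + a by lra.
have h2 : 0 < pi - b by lra.
have h1' := ltW h1; have h2' := ltW h2.
apply: divr_ge0; last by rewrite !mulr_ge0.
by apply: mulr_ge0; rewrite addr_ge0// mulr_ge0.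
Qed.

(** * Upper bounds for the trapezoid by its two legs and its plateau *)

Section bounds.
Variables a b y : R.
Hypotheses (a1 : 0 < pi + a) (b1 : 0 < pi - b).

(** Both kernels are bounded by their branch that vanishes at [y = - pi]; the right leg uses the
    branches vanishing at [y = pi]. *)
Lemma trapezoid_le_left :
  trapezoid a b y <= ((pi + a) + (pi - b)) / (4 * (pi + a)) * (pi + y).
Proof.
have -> : ((pi + a) + (pi - b)) / (4 * (pi + a)) * (pi + y) =
  ((pi - b) * ((pi + y) * (pi - a) / (2 * pi)) + (pi + a) * ((pi + y) * (pi - b) / (2 * pi)))
  * ((pi + a) + (pi - b)) / (4 * (pi + a) * (pi - b)).
  move: pi0 a1 b1; generalize (pi : R) => p p0 a0 b0.
  by field; rewrite !gt_eqF.
rewrite /trapezoid ler_pM2r; last by rewrite invr_gt0 !mulr_gt0.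
rewrite ler_pM2r; last by rewrite addr_gt0.
by apply: lerD; rewrite ler_pM2l// Green_le1.
Qed.

Lemma trapezoid_le_right :
  trapezoid a b y <= ((pi + a) + (pi - b)) / (4 * (pi - b)) * (pi - y).
Proof.
have -> : ((pi + a) + (pi - b)) / (4 * (pi - b)) * (pi - y) =
  ((pi - b) * ((pi - y) * (pi + a) / (2 * pi)) + (pi + a) * ((pi - y) * (pi + b) / (2 * pi)))
  * ((pi + a) + (pi - b)) / (4 * (pi + a) * (pi - b)).
  move: pi0 a1 b1; generalize (pi : R) => p p0 a0 b0.
  by field; rewrite !gt_eqF.
rewrite /trapezoid ler_pM2r; last by rewrite invr_gt0 !mulr_gt0.
rewrite ler_pM2r; last by rewrite addr_gt0.
by apply: lerD; rewrite ler_pM2l// Green_le2.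
Qed.

(** Taking the decreasing branch for [Green a] and the increasing one for [Green b], the dependence
    on [y] cancels. *)
Lemma trapezoid_le_top : trapezoid a b y <= ((pi + a) + (pi - b)) / 4.
Proof.
have -> : ((pi + a) + (pi - b)) / 4 =
  ((pi - b) * ((pi - y) * (pi + a) / (2 * pi)) + (pi + a) * ((pi + y) * (pi - b) / (2 * pi)))
  * ((pi + a) + (pi - b)) / (4 * (pi + a) * (pi - b)).
  move: pi0 a1 b1; generalize (pi : R) => p p0 a0 b0.
  by field; rewrite !gt_eqF.
rewrite /trapezoid ler_pM2r; last by rewrite invr_gt0 !mulr_gt0.
rewrite ler_pM2r; last by rewrite addr_gt0.
by apply: lerD; rewrite ler_pM2l// ?Green_le1 ?Green_le2.
Qed.

End bounds.

Lemma measurable_trapezoid D a b : measurable_fun D (trapezoid a b).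
Proof.
apply: measurable_funM => //; apply: measurable_funM => //.
by apply: measurable_funD; apply: measurable_funM => //; exact: measurable_Green.
Qed.

Lemma measurable_sym_trapezoid D r : measurable_fun D (sym_trapezoid r).
Proof.
apply: measurable_funTS; apply: measurable_funM => //; apply: measurable_funB => //.
by apply: measurable_maxr => //; exact: measurableT_comp.
Qed.

Lemma sym_trapezoid_ge0 r y : `|r| <= pi -> `|y| <= pi -> 0 <= sym_trapezoid r y.
Proof. by move=> rpi ypi; rewrite divr_ge0// subr_ge0 ge_max rpi. Qed.

Lemma sym_trapezoid_gt r s y : (s < sym_trapezoid r y) =
  (s < (pi - `|r|) / 2) && (2 * `|y| < 2 * pi - 4 * s).
Proof.
rewrite /sym_trapezoid !ltr_pdivlMr// ltrBrDr -ltrBrDl gt_max !ltrBrDl.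
congr (_ && _); first by rewrite addrC.
by apply/idP/idP; lra.
Qed.

End GreenFunction.

(** * Potentials *)

Lemma lipschitz_continuous_real {R : realType} (w : R -> R) (C : R) :
  (forall x y, `|w x - w y| <= `|x - y| * C) -> continuous w.
Proof.
move=> wC x; apply/cvgrPdist_lt => e e0.
(* The sign of [C] is unknown, so a positive constant above it replaces it as divisor. *)
have C0 : 0 < `|C| + 1 by rewrite ltr_wpDl.
near=> y; apply: (le_lt_trans (wC x y)).
apply: (@le_lt_trans _ _ (`|x - y| * (`|C| + 1))).
  by rewrite ler_wpM2l// (le_trans (ler_norm _))// lerDl.
rewrite -ltr_pdivlMr//; near: y.
by apply: cvgr_dist_lt; [exact: cvg_id|rewrite divr_gt0].
Unshelve. all: by end_near. Qed.

(* The carrier [T] is kept abstract because the library equips [R] with two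
   (convertible) measurable structures, one for [lebesgue_measure] and one for
   an arbitrary [{measure set R -> \bar R}]; [e] is the identity in both cases. *)
Section Potential.
Context d (T : measurableType d) {R : realType}.
Variables (m : {measure set T -> \bar R}) (D : set T) (e k : T -> R).
Hypotheses (mD : measurable D) (me : measurable_fun D e).
Hypothesis epi : forall y, D y -> `|e y| <= pi.
Hypothesis ik : m.-integrable D (EFin \o k).

Lemma integrable_Green (x : R) :
  m.-integrable D (EFin \o (fun y => Green x (e y) * k y)).
Proof.
apply: (@integrableMr _ _ _ _ _ mD (Green x \o e) (EFin \o k)) => //.
  by apply: (measurable_comp measurableT) => //; exact: measurable_Green.
exists (`|x| + pi); split; first exact: num_real.
by move=> c xc y /epi ypi; apply/ltW/(le_lt_trans _ xc)/Green_le.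
Qed.

(** [Green_lipschitz] integrated against [|k|]. The weight [k] covers both potentials: [k = 1] for
    [mu], and [k = fsharp f] for Lebesgue measure. *)
Lemma potential_lipschitz (x x' : R) :
  `|\int[m]_(y in D) (Green x (e y) * k y) - \int[m]_(y in D) (Green x' (e y) * k y)|
  <= `|x - x'| * \int[m]_(y in D) `|k y|.
Proof.
have ink : m.-integrable D (EFin \o (fun y => `|k y|)) by exact: integrable_norm.
rewrite -RintegralB//; [|exact: integrable_Green..].
rewrite -RintegralZl//.
have iB : m.-integrable D
    (EFin \o (fun y => Green x (e y) * k y - Green x' (e y) * k y)).
  by have /= := integrableB mD (integrable_Green x) (integrable_Green x').
apply: (le_trans (le_normr_Rintegral mD iB)).
apply: le_Rintegral => //.
- exact: integrable_norm iB.
- by have /= := integrableZl mD `|x - x'| ink.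
- move=> y /epi ypi; rewrite -mulrBl normrM ler_wpM2r//.
  exact: Green_lipschitz.
Qed.

End Potential.

(** * Puncturing the interval and reflecting it *)

Section Reflection.
Context {R : realType}.
Local Notation lam := (@lebesgue_measure R).

Lemma integral_Ipi0 (h : R -> \bar R) : measurable_fun Ipi0 h ->
  (\int[lam]_(y in Ipi) h y = \int[lam]_(y in Ipi0) h y)%E.
Proof. by move=> mh; rewrite /Ipi0 integral_setD1//; exact: measurable_Ipi0. Qed.

Lemma integral_Ipi0N (h : R -> \bar R) : measurable_fun Ipi0 h ->
  (forall y, Ipi0 y -> (0 <= h y)%E) ->
  (\int[lam]_(y in Ipi0) h y = \int[lam]_(y in Ipi0) h (- y)%R)%E.
Proof.
move=> mh h0.
have ID : (-%R : R -> measurableTypeR R) @^-1` Ipi0 = Ipi0.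
  by apply/seteqP; split=> x /=; rewrite !Ipi0P normrN.
rewrite -[X in (_ = \int[_]_(y in X) _)%E]ID -ge0_integral_pushforward//=.
- by apply: eq_measure_integral => A mA AS; exact/esym/lebesgue_measureN.
- exact: measurable_Ipi0.
- by move=> y /set_mem; exact: h0.
Qed.

End Reflection.

(** * L^p norms on [[-pi, pi]] *)

Section LnormOnJ.
Context {R : realType}.
Local Notation lam := (@lebesgue_measure R).
Implicit Types (U V : R -> R) (c t r x : R).
Local Notation above U t := (Jpi `&` [set x | (t < U x)%R]).

Lemma measurable_Jpi : measurable (Jpi : set R).
Proof. exact: measurable_itv. Qed.

Let mJ := measurable_Jpi.

Lemma Lnorm_onJ U r : (forall x, Jpi x -> 0 <= U x) -> 0 < r ->
  Lnorm lam r%:E (onJ U) = ((\int[lam]_(x in Jpi) (U x `^ r)%:E) `^ r^-1)%E.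
Proof.
move=> U0 r0; rewrite unlock /Lnorm; congr (_ `^ _)%E.
rewrite [RHS]integral_mkcond; apply: eq_integral => x _.
rewrite patchE /onJ; case: ifPn => [/set_mem Jx|/negP Jx].
  by rewrite ifT; [rewrite /= ger0_norm ?U0|apply/asboolP].
rewrite ifF; last by apply/negbTE/negP => /asboolP/mem_set.
by rewrite abse0 poweR0r// gt_eqF.
Qed.

(** Since [c >= 0], points outside [Jpi], where [onJ U] is zero, never exceed the bound. *)
Lemma ess_sup_onJ U c : measurable_fun Jpi U -> (forall x, Jpi x -> 0 <= U x) ->
  0 <= c -> (ess_sup lam (abse \o onJ U) <= c%:E)%E <-> lam (above U c) = 0%E.
Proof.
move=> mU U0 c0.
have mA : measurable (above U c).
  exact: (measurable_above (T := measurableTypeR R) mJ c mU).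
have onJE x : (abse (onJ U x) <= c%:E)%E <-> ~ above U c x.
  rewrite /onJ; case: asboolP => Jx; last by rewrite abse0 lee_fin; split=> // _ [].
  rewrite /= ger0_norm ?U0// lee_fin leNgt; split=> [/negP h [] //|h].
  by apply/negP => h'; apply: h.
split=> [/ess_supP [N [mN N0 DN]]|h].
  apply: (subset_measure0 (mu := lam) mA mN) => // x Ax; apply: DN => /=.
  by move/onJE; apply.
apply/ess_supP; exists (above U c); split=> // x /=.
by apply: contra_notP => /onJE.
Qed.

Lemma powR_above U t r : (forall x, Jpi x -> 0 <= U x) -> 0 < r -> 0 <= t ->
  above (fun x => U x `^ r) t = above U (t `^ r^-1).
Proof.
move=> U0 r0 t0; apply/seteqP; split => x [Jx /= h]; split => //=.
- have := gt0_ltr_powR (r := r^-1); rewrite invr_gt0 => /(_ r0 _ _ _ _ h).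
  rewrite -powRrM mulfV ?gt_eqF// powRr1 ?U0//; apply => //.
  by rewrite nnegrE powR_ge0.
- have := gt0_ltr_powR r0 _ _ h; rewrite -powRrM mulVf ?gt_eqF// powRr1//.
  by apply; rewrite nnegrE ?powR_ge0 ?U0.
Qed.

Lemma measurable_powR_fun U r : measurable_fun Jpi U ->
  measurable_fun Jpi (fun x => U x `^ r).
Proof.
by move=> mU; apply: (@measurableT_comp _ _ _ _ _ _ (fun y : R => y `^ r)).
Qed.

(** Layer cake, using that [{U ^ r > t}] is the superlevel set of [U] at height [t ^ (1 / r)]. *)
Lemma integral_powR_le U V r :
  measurable_fun Jpi U -> measurable_fun Jpi V ->
  (forall x, Jpi x -> 0 <= U x) -> (forall x, Jpi x -> 0 <= V x) ->
  (forall t, 0 <= t -> (lam (above U t) <= lam (above V t))%E) -> 0 < r ->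
  (\int[lam]_(x in Jpi) (U x `^ r)%:E <= \int[lam]_(x in Jpi) (V x `^ r)%:E)%E.
Proof.
move=> mU mV U0 V0 UV r0.
have mUr := measurable_powR_fun r mU; have mVr := measurable_powR_fun r mV.
have LC W : measurable_fun Jpi (fun x => W x `^ r) -> _ :=
  fun mW => layer_cake1 lam mJ mW (fun x _ => powR_ge0 (W x) r).
rewrite (LC _ mUr) (LC _ mVr); apply: ge0_le_integral => //.
- exact: (measurable_measure_above lam mJ mUr).
- exact: (measurable_measure_above lam mJ mVr).
- move=> t /=; rewrite in_itv/= andbT => t0.
  rewrite (powR_above U0 r0 t0) (powR_above V0 r0 t0).
  by apply: UV; exact: powR_ge0.
Qed.

(** Selects the essential supremum branch in the definition of [Lnorm] at exponent [+oo]. *)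
Lemma lebesgue_setT_gt0 : (0 < lam [set: R])%E.
Proof.
apply: (@lt_le_trans _ _ (lam `[0, 1]%classic)).
  by rewrite lebesgue_measure_itv/= lte01 oppr0 adde0.
by apply: le_measure; rewrite ?inE.
Qed.

Section comparison.
Variables U V : R -> R.
Hypotheses (mU : measurable_fun Jpi U) (mV : measurable_fun Jpi V).
Hypotheses (U0 : forall x, Jpi x -> 0 <= U x) (V0 : forall x, Jpi x -> 0 <= V x).
Hypothesis UV : forall t, 0 <= t -> (lam (above U t) <= lam (above V t))%E.

Lemma Lnorm_onJ_le p : (1 <= p)%E -> (Lnorm lam p (onJ U) <= Lnorm lam p (onJ V))%E.
Proof.
case: p => [r| |]; last by rewrite leeNy_eq.
  rewrite lee_fin => r1; have r0 : 0 < r by exact: lt_le_trans r1.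
  rewrite !Lnorm_onJ//; apply: gt0_ler_poweR.
  - by rewrite invr_ge0 ltW.
  - by rewrite in_itv/= leey andbT integral_ge0// => x _; rewrite lee_fin powR_ge0.
  - by rewrite in_itv/= leey andbT integral_ge0// => x _; rewrite lee_fin powR_ge0.
  - by apply: integral_powR_le.
move=> _; rewrite unlock /Lnorm/= lebesgue_setT_gt0.
have : (0 <= ess_sup lam (abse \o onJ V))%E.
  by apply: ess_sup_gee; [exact: lebesgue_setT_gt0|apply/nearW => x; exact: abse_ge0].
case E : (ess_sup lam (abse \o onJ V)) => [c| |//]; last by move=> _; rewrite leey.
rewrite lee_fin => c0; apply/ess_sup_onJ => //.
apply/eqP; rewrite -measure_le0; apply: (le_trans (UV c0)).
have [-> //] := ess_sup_onJ mV V0 c0.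
by rewrite E.
Qed.

(** For finite exponents a truncation of [V] is inserted between [U] and [V]; the bound [K] makes
    the integral of [V ^ r] finite. At [+oo] the essential suprema are separated by [A < B]. *)
Lemma Lnorm_onJ_lt p (A B K : R) : (1 <= p)%E ->
  0 <= A -> A < B -> (forall x, Jpi x -> U x <= A) -> (forall x, Jpi x -> V x <= K) ->
  (0 < lam (above V B))%E -> (Lnorm lam p (onJ U) < Lnorm lam p (onJ V))%E.
Proof.
move=> + A0 AB UA VK VB.
have B0 : 0 <= B by rewrite ltW// (le_lt_trans A0).
case: p => [r| |]; last by rewrite leeNy_eq.
  rewrite lee_fin => r1; have r0 : 0 < r by exact: lt_le_trans r1.
  rewrite !Lnorm_onJ//.
  (* As [U <= A], truncating [V] at [A] preserves the comparison of superlevel sets, while [W < V]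
     on [{V > B}], a set of positive measure. *)
  pose W x := Num.min (V x) A.
  have mW : measurable_fun Jpi W by apply: measurable_minr => //; exact: measurable_cst.
  have W0 x : Jpi x -> 0 <= W x by move=> Jx; rewrite le_min V0.
  have UW : (\int[lam]_(x in Jpi) (U x `^ r)%:E <= \int[lam]_(x in Jpi) (W x `^ r)%:E)%E.
    apply: integral_powR_le => // t t0; have [tA|At] := ltP t A.
      rewrite [X in (_ <= _ X)%E](_ : _ = above V t); first exact: UV.
      by apply/seteqP; split => x [Jx /=]; rewrite lt_min tA andbT.
    rewrite [X in (_ X <= _)%E](_ : _ = set0) ?measure0//.
    apply/seteqP; split => x // -[/UA Ux /=]; rewrite ltNge (le_trans Ux)//.
  have mVr : measurable_fun Jpi (fun x => (V x `^ r)%:E).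
    by apply/measurable_EFinP; exact: measurable_powR_fun.
  have mWr : measurable_fun Jpi (fun x => (W x `^ r)%:E).
    by apply/measurable_EFinP; exact: measurable_powR_fun.
  have WV x : Jpi x -> ((W x `^ r)%:E <= (V x `^ r)%:E)%E.
    move=> Jx; rewrite lee_fin ge0_ler_powR ?nnegrE ?W0 ?V0 ?(ltW r0)//.
    by rewrite ge_min lexx.
  have Voo : (\int[lam]_(x in Jpi) (V x `^ r)%:E < +oo)%E.
    apply: (@le_lt_trans _ _ (\int[lam]_(x in Jpi) (cst (K `^ r)%:E) x)%E).
      apply: ge0_le_integral => //.
      - by move=> x _; rewrite lee_fin powR_ge0.
      - move=> x Jx; rewrite /= lee_fin ge0_ler_powR ?nnegrE ?V0 ?VK ?(ltW r0)//.
        by rewrite (le_trans (V0 Jx))// VK.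
    rewrite integral_cst//= /Jpi lebesgue_measure_itv/=.
    by case: ifP => _; rewrite ?mule0 ?ltry// -EFinD -EFinM ltry.
  have WVlt : (\int[lam]_(x in Jpi) (W x `^ r)%:E < \int[lam]_(x in Jpi) (V x `^ r)%:E)%E.
    rewrite lt_neqAle; apply/andP; split; last first.
      by apply: ge0_le_integral => // x _; rewrite lee_fin powR_ge0.
    apply/eqP => WVE.
    have [N [mN N0 DN]] : {ae lam, forall x, Jpi x -> (W x `^ r)%:E = (V x `^ r)%:E}.
      by apply: ae_eq_of_le_integral => // x _; rewrite lee_fin powR_ge0.
    have mB : measurable (above V B).
      exact: (measurable_above (T := measurableTypeR R) mJ B mV).
    move: VB; rewrite (subset_measure0 (mu := lam) mB mN _ N0) ?ltxx// => x [Jx /= VB].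
    apply: DN => /= /(_ Jx) -[] /(powR_injective r0); rewrite !nnegrE W0// V0//.
    move=> /(_ isT isT); rewrite /W => WE.
    have : Num.min (V x) A <= A by rewrite ge_min lexx orbT.
    by rewrite WE leNgt (lt_trans AB VB).
  have UVlt := le_lt_trans UW WVlt.
  have IU0 : (0 <= \int[lam]_(x in Jpi) (U x `^ r)%:E)%E.
    by apply: integral_ge0 => x _; rewrite lee_fin powR_ge0.
  have IV0 := le_trans IU0 (ltW UVlt).
  move: UVlt IU0 IV0 Voo; case: (\int[_]_(x in _) _)%E => [u| |] //; last first.
    by rewrite ltNge leey.
  case: (\int[_]_(x in _) _)%E => [v| |] // uv u0 v0 _.
  by rewrite !poweR_EFin lte_fin gt0_ltr_powR ?invr_gt0 ?nnegrE.
move=> _; rewrite unlock /Lnorm/= lebesgue_setT_gt0.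
apply: (@le_lt_trans _ _ A%:E).
  apply/ess_sup_onJ => //; rewrite (_ : above U A = set0) ?measure0//.
  by apply/seteqP; split => x // -[/UA Ux /=]; rewrite ltNge Ux.
apply: (@lt_trans _ _ B%:E); first by rewrite lte_fin.
rewrite ltNge; apply/negP => /ess_sup_onJ => /(_ mV V0 B0) h.
by rewrite h ltxx in VB.
Qed.

End comparison.
End LnormOnJ.

(** * Comparison of the two potentials *)

(** A bare measure of finite total mass is replaced by its restriction to the whole space, which
    carries the finite measure structure and has the same values. *)
Lemma layer_cake_finite d (T : measurableType d) (R : realType)
    (m : {measure set T -> \bar R}) (D : set T) (g : T -> R) :
  (m setT < +oo)%E -> measurable D -> measurable_fun D g ->
  (forall x, D x -> 0 <= g x) ->
  measurable_fun (`[0%R, +oo[%classic : set R)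
    (fun t => m (D `&` [set x | (t < g x)%R])) /\
  (\int[m]_(x in D) (g x)%:E =
   \int[lebesgue_measure]_(t in `[0%R, +oo[) m (D `&` [set x | (t < g x)%R]))%E.
Proof.
move=> moo mD mg g0.
pose n : {finite_measure set T -> \bar R} := mfrestr measurableT moo.
have nm A : n A = m A by rewrite /n /= /mfrestr /mrestr setIT.
split.
  have := @measurable_measure_above _ _ _ n _ mD _ mg.
  by apply: eq_measurable_fun => t _; exact: nm.
rewrite (@eq_measure_integral _ _ _ _ n); last by move=> A _ _; exact/esym/nm.
by rewrite layer_cake1//; apply: eq_integral => t _; exact: nm.
Qed.

Section Comparison.
Context {R : realType}.
Local Notation lam := (@lebesgue_measure R).
Variables (mu s : {measure set R -> \bar R}) (f : R -> R).
Hypothesis mu_fin : (mu setT < +oo)%E.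
Hypothesis f_ge0 : forall x, Ipi x -> 0 <= f x.
Hypothesis f_int : lam.-integrable Ipi (EFin \o f).
Hypothesis s_supp : s (~` Ipi) = 0%E.
Hypothesis decomp : forall A : set R, measurable A ->
  mu A = (\int[lam]_(x in A `&` Ipi) (f x)%:E + s A)%E.

Let M := fine (s Ipi).
Let mI := @measurable_Ipi R.
Let mI0 := @measurable_Ipi0 R.
Let mf : measurable_fun Ipi f.
Proof. by apply/measurable_EFinP; exact: measurable_int f_int. Qed.
Let mf0 : measurable_fun Ipi0 f := measurable_funS mI (@Ipi0_sub R) mf.
Let mF := measurable_fsharp f_ge0 f_int.
Let F_ge0 := fsharp_ge0 f_ge0 f_int.

(** * Integration against the decomposed measure and its symmetrization *)

Lemma singular_fin : (s setT < +oo)%E.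
Proof.
apply: le_lt_trans mu_fin; rewrite (decomp measurableT) setTI leeDr//.
by apply: integral_ge0 => x Ix; rewrite lee_fin f_ge0.
Qed.

Lemma singular_IpiE : s Ipi = M%:E.
Proof.
rewrite /M fineK// ge0_fin_numE//; apply: le_lt_trans singular_fin.
by apply: le_measure; rewrite ?inE.
Qed.

Lemma singular_mass_ge0 : 0 <= M.
Proof. by rewrite fine_ge0. Qed.

(** The decomposition is given on sets only; layer cake applies it to each superlevel set of [g]. *)
Lemma integral_decomp (g : R -> R) : measurable_fun Ipi g ->
  (forall x, Ipi x -> 0 <= g x) ->
  (\int[mu]_(x in Ipi) (g x)%:E =
   \int[lam]_(x in Ipi) (g x * f x)%:E + \int[s]_(x in Ipi) (g x)%:E)%E.
Proof.
move=> mg g0.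
have [_ ->] := layer_cake_finite mu_fin mI mg g0.
have [ms ->] := layer_cake_finite singular_fin mI mg g0.
rewrite layer_cake// -ge0_integralD//.
- apply: eq_integral => t _; rewrite decomp; last exact: measurable_above.
  by rewrite setIAC setIid.
- by move=> t _; apply: integral_ge0 => x [Ix _]; rewrite lee_fin f_ge0.
- exact: measurable_integral_above.
Qed.

Lemma integral_fsharp : (\int[lam]_(x in Ipi0) (fsharp f x)%:E =
  \int[lam]_(x in Ipi) (f x)%:E)%E.
Proof.
rewrite integral_Ipi0; last exact/measurable_EFinP.
rewrite !layer_cake1//; last by move=> x /Ipi0_sub; exact: f_ge0.
by apply: eq_integral => t _ /=; rewrite fsharp_above_measure// above_Ipi0_measure.
Qed.

Lemma integrable_fsharp0 : lam.-integrable Ipi0 (EFin \o fsharp f).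
Proof.
apply/integrableP; split; first exact/measurable_EFinP.
suff -> : (\int[lam]_(x in Ipi0) `|(EFin \o fsharp f) x| =
    \int[lam]_(x in Ipi0) (fsharp f x)%:E)%E.
  by rewrite integral_fsharp ltey_eq integrable_fin_num.
by apply: eq_integral => x /set_mem Ix; rewrite /= ger0_norm// F_ge0.
Qed.

Lemma integrable_fsharp : lam.-integrable Ipi (EFin \o fsharp f).
Proof.
have [mF' Foo] := integrableP _ _ _ integrable_fsharp0.
have mFI : measurable_fun Ipi (EFin \o fsharp f).
  have -> : Ipi = [set 0] `|` Ipi0 :> set R by rewrite setDUK// => _ ->; exact: Ipi_zero.
  by apply/measurable_funU => //; split => //; exact: measurable_fun_set1.
apply/integrableP; split => //.
by rewrite integral_Ipi0//; exact: measurableT_comp.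
Qed.

(** As [fsharp f] is even, the kernel may be averaged over [y] and [- y], and [Green_sym] evaluates
    the average. *)
Lemma integral_Green_fsharp (x : R) : `|x| <= pi ->
  (\int[lam]_(y in Ipi) (Green x y * fsharp f y)%:E =
   \int[lam]_(y in Ipi0) (fsharp f y * sym_trapezoid x y)%:E)%E.
Proof.
move=> xpi.
have mG (g : R -> R) : measurable_fun Ipi0 g ->
  measurable_fun Ipi0 (fun y => (g y * fsharp f y)%:E).
  by move=> mg; apply/measurable_EFinP; exact: measurable_funM.
have mGx := mG _ (@measurable_Green _ Ipi0 x).
have Ipos y : Ipi0 y -> `|y| <= pi by move=> /Ipi0P/andP[_ /ltW].
rewrite integral_Ipi0//.
have mGN : measurable_fun Ipi0 (fun y : R => Green x (- y)).
  apply: measurable_funTS; apply: (@measurableT_comp _ _ _ _ _ _ (Green x)) => //.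
  exact: measurable_Green.
have G1 y : Ipi0 y -> (0 <= (Green x y * fsharp f y)%:E)%E.
  by move=> Iy; rewrite lee_fin mulr_ge0 ?F_ge0// Green_ge0// Ipos.
have G2 y : Ipi0 y -> (0 <= (Green x (- y) * fsharp f y)%:E)%E.
  by move=> Iy; rewrite lee_fin mulr_ge0 ?F_ge0// Green_ge0// normrN Ipos.
have symG : (\int[lam]_(y in Ipi0) (Green x y * fsharp f y)%:E =
    \int[lam]_(y in Ipi0) (Green x (- y) * fsharp f y)%:E)%E.
  by rewrite integral_Ipi0N//; apply: eq_integral => y _; rewrite /fsharp normrN.
pose h : R := 2^-1.
have h0 : 0 <= h by rewrite invr_ge0.
transitivity (h%:E * \int[lam]_(y in Ipi0) (Green x y * fsharp f y)%:E +
    h%:E * \int[lam]_(y in Ipi0) (Green x (- y) * fsharp f y)%:E)%E.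
  rewrite -symG -ge0_muleDl ?lee_fin// -EFinD.
  by rewrite (_ : h + h = 1) ?mul1e// /h; lra.
rewrite -!ge0_integralZl_EFin//; last exact: mG.
rewrite -ge0_integralD//.
- apply: eq_integral => y _; rewrite -!EFinM -EFinD /sym_trapezoid -Green_sym /h.
  by congr EFin; lra.
- by move=> y Iy; rewrite mule_ge0// G1.
- by apply: measurable_funeM.
- by move=> y Iy; rewrite mule_ge0// G2.
- by apply: measurable_funeM; exact: mG.
Qed.

Lemma u_sharpE (x : R) : `|x| <= pi ->
  (u_sharp f M x)%:E = (\int[lam]_(y in Ipi0) (fsharp f y * sym_trapezoid x y)%:E
   + (M * ((pi - `|x|) / 2))%:E)%E.
Proof.
move=> xpi; rewrite /u_sharp Green0 EFinD; congr (_ + _)%E.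
rewrite fineK ?integral_Green_fsharp//.
rewrite -integral_Green_fsharp//; apply: integrable_fin_num => //.
apply: (@integrable_Green _ _ _ lam Ipi id _ mI (@measurable_id _ _ _) _ integrable_fsharp).
by move=> y /IpiP/ltW.
Qed.

(** The density part is compared with [sym_trapezoid r] by Hardy-Littlewood. The singular part is at
    most its mass times the plateau height, which is exactly [M * Green r 0]. *)
Lemma trapezoid_comparison (a b : R) : Ipi a -> Ipi b -> a <= b ->
  (\int[mu]_(y in Ipi) (trapezoid a b y)%:E <=
   (u_sharp f M ((b - a) / 2))%:E)%E.
Proof.
move=> Ia Ib ab.
have /andP[a1 a2] : - pi < a < pi by move: Ia; rewrite /Ipi/= in_itv.
have /andP[b1 b2] : - pi < b < pi by move: Ib; rewrite /Ipi/= in_itv.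
have al : 0 < pi + a by lra.
have be : 0 < pi - b by lra.
set r := (b - a) / 2.
have r0 : 0 <= r by rewrite /r; lra.
have rpi : `|r| < pi by rewrite ger0_norm// /r; lra.
have Ipos y : Ipi0 y -> `|y| <= pi by move=> /Ipi0P/andP[_ /ltW].
have top : ((pi + a) + (pi - b)) / 4 = (pi - `|r|) / 2.
  by rewrite ger0_norm// /r; lra.
have mT D := @measurable_trapezoid R D a b.
have T0 y : Ipi y -> 0 <= trapezoid a b y by exact: trapezoid_ge0.
rewrite integral_decomp// u_sharpE; last exact: ltW.
apply: leeD.
  rewrite integral_Ipi0; last first.
    by apply/measurable_EFinP; exact: measurable_funM.
  under eq_integral do rewrite mulrC.
  apply: hardy_littlewood => //.
  - exact: mT.
  - exact: measurable_sym_trapezoid.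
  - by move=> y /Ipi0_sub; exact: f_ge0.
  - by move=> y /Ipi0_sub; exact: T0.
  - by move=> y Iy; apply: sym_trapezoid_ge0; [exact: ltW|exact: Ipos].
  - by move=> t _ /=; rewrite fsharp_above_measure// above_Ipi0_measure.
  - move=> t t0 /=; have [tr|rt] := ltP t ((pi - `|r|) / 2); last first.
      rewrite [X in (_ X <= _)%E](_ : _ = set0) ?measure0//.
      apply/seteqP; split => y // -[_ /=]; rewrite ltNge => /negP; apply.
      by apply: le_trans rt; rewrite -top; exact: trapezoid_le_top.
    pose S := (pi + a) + (pi - b).
    have S0 : 0 < S by rewrite addr_gt0.
    rewrite (_ : Ipi0 `&` [set x | t < sym_trapezoid r x] =
        Ipi0 `&` [set x | 2 * `|x| < 2 * pi - 4 * t]); last first.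
      by apply/seteqP; split => y [Iy /=]; rewrite sym_trapezoid_gt tr.
    rewrite lebesgue_Ipi0_centered; last first.
      by have := normr_ge0 r; move: tr; lra.
    (* The points where the two legs reach height [t]; their distance is the length of the
       superlevel set of [sym_trapezoid r] at [t]. *)
    pose p := - pi + 4 * (pi + a) * t / S; pose q := pi - 4 * (pi - b) * t / S.
    have pq : q - p = 2 * pi - 4 * t.
      move: S0; rewrite /q /p /S; generalize (pi : R) => c S0.
      by field; rewrite gt_eqF.
    apply: (@le_trans _ _ (lam `]p, q[%classic)).
      apply: le_measure; rewrite ?inE//.
        exact: (measurable_above (T := measurableTypeR R) mI0 t (mT Ipi0)).
      move=> y [_ /= ty]; rewrite in_itv/=; apply/andP; split.
        have := lt_le_trans ty (@trapezoid_le_left R a b y al be).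
        rewrite -/S -ltr_pdivrMl ?divr_gt0 ?mulr_gt0// invf_div => h.
        by rewrite /p; lra.
      have := lt_le_trans ty (@trapezoid_le_right R a b y al be).
      rewrite -/S -ltr_pdivrMl ?divr_gt0 ?mulr_gt0// invf_div => h.
      by rewrite /q; lra.
    rewrite lebesgue_measure_itv/= lte_fin; case: ifPn => _.
      by rewrite -EFinD lee_fin pq.
    by rewrite lee_fin; have := normr_ge0 r; move: tr; lra.
  (* Both superlevel sets are centred intervals or empty, hence nested. *)
  - move=> t t' t0 t'0.
    rewrite fsharp_above//.
    have [tr|rt] := ltP t' ((pi - `|r|) / 2); last first.
      right => y [_ /=]; rewrite sym_trapezoid_gt ltNge rt//.
    have [cc|cc] := leP (fine (lam [set x | Ipi x /\ t < f x])) (2 * pi - 4 * t');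
      [left|right] => y [Iy /=].
      move=> h; split => //=; rewrite sym_trapezoid_gt tr/=.
      exact: lt_le_trans cc.
    rewrite sym_trapezoid_gt tr/= => h; split => //=.
    exact: lt_trans cc.
rewrite mulrC EFinM -singular_IpiE -top.
rewrite -integral_cst//.
apply: ge0_le_integral => //.
- by apply/measurable_EFinP; exact: mT.
- by move=> y _; rewrite /= lee_fin trapezoid_le_top.
Qed.

(** * Regularity, sign and monotonicity of the two potentials *)

Local Notation u := (u_meas mu).
Local Notation v := (u_sharp f M).

Let Ipi_norm (y : R) : Ipi y -> `|id y| <= pi.
Proof. by move=> /IpiP/ltW. Qed.

Let i1 : mu.-integrable Ipi (EFin \o cst (1 : R)).
Proof.
apply: measurable_bounded_integrable => //.
  by apply: le_lt_trans mu_fin; apply: le_measure; rewrite ?inE.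
exists 1; split; first exact: num_real.
by move=> x x1 y _ /=; rewrite normr1 ltW.
Qed.

Let u_measE (x : R) :
  u x = \int[mu]_(y in Ipi) (Green x (id y) * (cst 1 : R -> R) y).
Proof. by congr fine; apply: eq_integral => y _; rewrite /= mulr1. Qed.

Let integrable_Green_mu (x : R) : mu.-integrable Ipi (EFin \o Green x).
Proof.
have := integrable_Green mI (@measurable_id _ _ _) Ipi_norm i1 x.
by apply: eq_integrable => // y _; rewrite /= mulr1.
Qed.

Lemma u_meas_lipschitz : exists C : R, forall x y, `|u x - u y| <= `|x - y| * C.
Proof.
exists (\int[mu]_(y in Ipi) `|(cst 1 : R -> R) y|) => x y; rewrite !u_measE.
exact: potential_lipschitz mI (@measurable_id _ _ _) Ipi_norm i1 x y.
Qed.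

Lemma u_sharp_lipschitz : exists C : R, forall x y, `|v x - v y| <= `|x - y| * C.
Proof.
pose k := \int[lam]_(y in Ipi) `|fsharp f y|.
have P x y : `|\int[lam]_(z in Ipi) (Green x z * fsharp f z) -
    \int[lam]_(z in Ipi) (Green y z * fsharp f z)| <= `|x - y| * k.
  exact: (@potential_lipschitz _ (measurableTypeR R) R lam Ipi id (fsharp f) mI
    (@measurable_id _ _ _) Ipi_norm integrable_fsharp x y).
exists (k + M / 2) => x y.
rewrite /u_sharp !Green0 opprD addrACA -mulrBr [leRHS]mulrDr.
apply: (le_trans (ler_normD _ _)); apply: lerD; first exact: P.
rewrite normrM ger0_norm ?singular_mass_ge0//.
rewrite [leRHS]mulrCA ler_wpM2l ?singular_mass_ge0//.
rewrite -mulrBl normrM [`|2^-1|]ger0_norm// ler_wpM2r//.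
rewrite (_ : _ - _ = `|y| - `|x|); last by ring.
by rewrite distrC; apply: ler_dist_dist.
Qed.

Lemma measurable_u_meas : measurable_fun Jpi u.
Proof.
have [C uC] := u_meas_lipschitz; apply: measurable_funTS.
apply: continuous_measurable_fun; exact: (lipschitz_continuous_real uC).
Qed.

Lemma measurable_u_sharp : measurable_fun Jpi v.
Proof.
have [C vC] := u_sharp_lipschitz; apply: measurable_funTS.
apply: continuous_measurable_fun; exact: (lipschitz_continuous_real vC).
Qed.

Lemma JpiP (x : R) : Jpi x <-> `|x| <= pi.
Proof. by rewrite /Jpi /= in_itv/= ler_norml. Qed.

Lemma u_meas_ge0 (x : R) : Jpi x -> 0 <= u x.
Proof.
move=> /JpiP xpi; apply: fine_ge0; apply: integral_ge0 => y /Ipi_norm ypi.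
by rewrite lee_fin Green_ge0.
Qed.

(** The kernel vanishes at [x = pi] and [x = - pi], so the potential does too. *)
Lemma u_meas_gt0_Ipi (x : R) : Jpi x -> 0 < u x -> Ipi x.
Proof.
move=> /JpiP; rewrite le_eqVlt => /predU1P[xpi|/IpiP//].
suff -> : u x = 0 by rewrite ltxx.
rewrite /u_meas [X in fine X]integral0_eq// => y /Ipi_norm/= ypi; congr EFin.
have pn0 : (pi : R) != 0 by rewrite gt_eqF ?pi_gt0.
move: ypi; rewrite /Green ler_norml => /andP[y1 y2].
have [x0|x0] := ger0P x; move: xpi.
  rewrite ger0_norm// => ->; rewrite ger0_norm ?subr_ge0//.
  by move: pn0; generalize (pi : R) => p pn0; field.
rewrite ltr0_norm// => /eqP; rewrite eqr_oppLR => /eqP ->.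
rewrite ler0_norm; last by lra.
by move: pn0; generalize (pi : R) => p pn0; field.
Qed.

(** Both [sym_trapezoid x z] and [(pi - |x|) / 2] are nonincreasing in [|x|]. *)
Lemma u_sharp_le (x y : R) : `|x| <= `|y| -> `|y| <= pi -> v y <= v x.
Proof.
move=> xy ypi; have xpi := le_trans xy ypi.
rewrite -lee_fin !u_sharpE//; apply: leeD.
  apply: ge0_le_integral => //.
  - move=> z Iz; rewrite lee_fin mulr_ge0 ?F_ge0// sym_trapezoid_ge0//.
    by have /Ipi0P/andP[_ /ltW] := Iz.
  - by apply/measurable_EFinP; apply: measurable_funM => //; exact: measurable_sym_trapezoid.
  - by apply/measurable_EFinP; apply: measurable_funM => //; exact: measurable_sym_trapezoid.
  - move=> z Iz; rewrite lee_fin ler_wpM2l ?F_ge0// /sym_trapezoid ler_pM2r//.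
    by rewrite lerD2l lerN2 ge_max !le_max lexx xy orbT.
rewrite lee_fin ler_wpM2l ?singular_mass_ge0//; lra.
Qed.

Lemma u_sharp_ge0 (x : R) : Jpi x -> 0 <= v x.
Proof.
move=> /JpiP xpi; rewrite -lee_fin u_sharpE//; apply: adde_ge0.
  apply: integral_ge0 => z Iz; rewrite lee_fin mulr_ge0 ?F_ge0// sym_trapezoid_ge0//.
  by have /Ipi0P/andP[_ /ltW] := Iz.
by rewrite lee_fin mulr_ge0 ?singular_mass_ge0// divr_ge0// subr_ge0.
Qed.

(** [trapezoid_comparison] with the scaling factor of the trapezoid moved to the right-hand side. *)
Lemma pair_comparison (a b : R) : Ipi a -> Ipi b -> a <= b ->
  (pi - b) * u a + (pi + a) * u b <=
  4 * (pi + a) * (pi - b) / ((pi + a) + (pi - b)) * v ((b - a) / 2).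
Proof.
move=> Ia Ib ab; have := trapezoid_comparison Ia Ib ab.
have /andP[a1 a2] : - pi < a < pi by move: Ia; rewrite /Ipi/= in_itv.
have /andP[b1 b2] : - pi < b < pi by move: Ib; rewrite /Ipi/= in_itv.
have al : 0 < pi + a by lra.
have be : 0 < pi - b by lra.
set S := (pi + a) + (pi - b); have S0 : 0 < S by rewrite addr_gt0.
pose c := S / (4 * (pi + a) * (pi - b)).
have c0 : 0 < c by rewrite divr_gt0 ?mulr_gt0.
have iT : mu.-integrable Ipi (EFin \o (fun y => (pi - b) * Green a y + (pi + a) * Green b y)).
  by have /= := integrableD mI (integrableZl mI (pi - b) (integrable_Green_mu a))
    (integrableZl mI (pi + a) (integrable_Green_mu b)).
have TE : \int[mu]_(y in Ipi) trapezoid a b y =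
    c * ((pi - b) * u a + (pi + a) * u b).
  transitivity (\int[mu]_(y in Ipi) (c * ((pi - b) * Green a y + (pi + a) * Green b y))).
    by congr fine; apply: eq_integral => y _; rewrite /trapezoid -/S -mulrA mulrC.
  rewrite RintegralZl// RintegralD//; last 2 first.
  - exact: (integrableZl mI (pi - b) (integrable_Green_mu a)).
  - exact: (integrableZl mI (pi + a) (integrable_Green_mu b)).
  by rewrite !RintegralZl//; exact: integrable_Green_mu.
have -> : 4 * (pi + a) * (pi - b) / S = c^-1 by rewrite invf_div.
move=> h; rewrite ler_pdivlMl// -TE /Rintegral.
(* The upper bound excludes [+oo], nonnegativity of the trapezoid excludes [-oo], so [fine] loses
   nothing. *)
move: h; case E : (\int[mu]_(y in Ipi) _)%E => [z| |] //=.
have : (0 <= \int[mu]_(y in Ipi) (trapezoid a b y)%:E)%E.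
  by apply: integral_ge0 => y Iy; rewrite lee_fin trapezoid_ge0.
by rewrite E.
Qed.

(** With [alpha = pi + a] and [beta = pi - b], the inequality [4 alpha beta <= (alpha + beta)^2]
    bounds a weighted mean of [u a] and [u b] by [v ((b - a) / 2)]. *)
Lemma u_meas_pair_lt (a b t : R) : 0 <= t -> Ipi a -> Ipi b -> a <= b ->
  t < u a -> t < u b -> t < v ((b - a) / 2).
Proof.
move=> t0 Ia Ib ab ta tb; have := pair_comparison Ia Ib ab.
have /andP[a1 a2] : - pi < a < pi by move: Ia; rewrite /Ipi/= in_itv.
have /andP[b1 b2] : - pi < b < pi by move: Ib; rewrite /Ipi/= in_itv.
have al : 0 < pi + a by lra.
have be : 0 < pi - b by lra.
set S := (pi + a) + (pi - b); have S0 : 0 < S by rewrite addr_gt0.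
have v0 : 0 <= v ((b - a) / 2).
  by apply: u_sharp_ge0; apply/JpiP; rewrite ger0_norm; lra.
have kS : 4 * (pi + a) * (pi - b) / S <= S.
  rewrite ler_pdivrMr// -subr_ge0.
  rewrite (_ : _ - _ = ((pi + a) - (pi - b)) ^+ 2) ?sqr_ge0//.
  by rewrite /S; move: (pi + a) (pi - b) => x y; ring.
move=> h; have h2 := le_trans h (ler_wpM2r v0 kS).
have h3 : (pi - b) * t + (pi + a) * t < (pi - b) * u a + (pi + a) * u b.
  by apply: ltrD; rewrite ltr_pM2l.
rewrite -(ltr_pM2l S0); apply: lt_le_trans h2; apply: le_lt_trans h3.
by rewrite -mulrDl addrC.
Qed.

Lemma u_meas_le_center (x : R) : Ipi x -> u x <= (1 - x ^+ 2 / pi ^+ 2) * v 0.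
Proof.
move=> Ix; have := pair_comparison Ix Ix (lexx x); rewrite subrr mul0r => h.
have p0 := pi_gt0 R; have pn0 : (pi : R) != 0 by rewrite gt_eqF.
rewrite -(@ler_pM2l _ (2 * pi)) ?mulr_gt0//.
have -> : 2 * pi * u x = (pi - x) * u x + (pi + x) * u x by ring.
apply: (le_trans h); rewrite mulrA le_eqVlt; apply/orP; left; apply/eqP.
congr (_ * _); rewrite (_ : pi + x + (pi - x) = 2 * pi); last by ring.
by move: pn0; generalize (pi : R) => p pn0; field.
Qed.

(** The set [E] lies between its infimum and supremum, and points of [E] nearly attaining them give
    a centred interval of nearly that length inside [{v > t}]. *)
Lemma superlevel_comparison (t : R) : 0 <= t ->
  (lam (Jpi `&` [set x | (t < u x)%R]) <= lam (Jpi `&` [set x | (t < v x)%R]))%E.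
Proof.
move=> t0; pose E := Jpi `&` [set x | (t < u x)%R].
have mE : measurable E.
  exact: (measurable_above (T := measurableTypeR R) measurable_Jpi t measurable_u_meas).
have mV : measurable (Jpi `&` [set x | (t < v x)%R]).
  exact: (measurable_above (T := measurableTypeR R) measurable_Jpi t measurable_u_sharp).
have EI x : E x -> Ipi x by case=> Jx /= tx; apply: u_meas_gt0_Ipi => //; exact: le_lt_trans tx.
rewrite -/E; have [->|/set0P E0] := eqVneq E set0; first by rewrite measure0.
have Eub : has_ubound E by exists pi => x /EI/IpiP/ltW; rewrite ler_norml => /andP[].
have Elb : has_lbound E by exists (- pi) => x /EI/IpiP/ltW; rewrite ler_norml => /andP[].
have sE : has_sup E by [].
have iE : has_inf E by [].
have infsup : inf E <= sup E.
  by have [x Ex] := E0; apply: (@le_trans _ _ x); [exact: ge_inf|exact: ub_le_sup].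
apply: (@le_trans _ _ (sup E - inf E)%:E).
  apply: (@le_trans _ _ (lam `[inf E, sup E]%classic)).
    apply: le_measure; rewrite ?inE// => x Ex.
    by rewrite /= in_itv/= ge_inf//= ub_le_sup.
  by rewrite lebesgue_measure_itv/= lte_fin; case: ifPn => _; rewrite lee_fin ?subr_ge0// lexx.
apply/lee_addgt0Pr => e e0.
have e20 : 0 < e / 2 by rewrite divr_gt0.
have [b Eb bs] := sup_adherent e20 sE.
have [a Ea ai] := inf_adherent e20 iE.
have key (p q : R) : E p -> E q -> p <= q ->
    ((q - p)%:E <= lam (Jpi `&` [set x | (t < v x)%R]))%E.
  move=> Ep Eq pq.
  have tv : t < v ((q - p) / 2).
    by apply: u_meas_pair_lt => //; [exact: EI|exact: EI|case: Ep|case: Eq].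
  have /IpiP := EI _ Ep; rewrite ltr_norml => /andP[p1 p2].
  have /IpiP := EI _ Eq; rewrite ltr_norml => /andP[q1 q2].
  apply: (@le_trans _ _ (lam `[- ((q - p) / 2), (q - p) / 2]%classic)).
    rewrite lebesgue_measure_itv/= lte_fin; case: ltP => h; rewrite -?EFinD lee_fin; lra.
  apply: le_measure; rewrite ?inE// => x; rewrite /= in_itv/= -ler_norml => xr.
  have rpi : (q - p) / 2 <= pi by lra.
  split; first by apply/JpiP/(le_trans xr).
  apply: (lt_le_trans tv); apply: u_sharp_le; last by rewrite ger0_norm//; lra.
  by rewrite [leRHS]ger0_norm//; lra.
(* If the near-extremal points come in the wrong order, the diameter of [E] is below [e] and the
   bound is trivial. *)
have [ab|ba] := leP a b.
  apply: (@le_trans _ _ ((b - a)%:E + e%:E)%E); first by rewrite -EFinD lee_fin; lra.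
  by rewrite leeD2r// key.
apply: (@le_trans _ _ (0 + e%:E)%E); first by rewrite add0e lee_fin; lra.
by rewrite leeD2r.
Qed.

(** Near the origin continuity keeps [u] away from [v 0]; farther out the factor [1 - x^2 / pi^2] of
    [u_meas_le_center] does. *)
Lemma strict_gap : u 0 < v 0 -> exists A B : R,
  [/\ 0 <= A, A < B, forall x, Jpi x -> u x <= A &
      (0 < lam (Jpi `&` [set x | (B < v x)%R]))%E].
Proof.
move=> uv; have p0 := pi_gt0 R.
have J0 : Jpi (0 : R) by apply/JpiP; rewrite normr0 ltW.
have u0 := u_meas_ge0 J0.
have v0 : 0 < v 0 by exact: le_lt_trans uv.
have [C uC] := u_meas_lipschitz; have [C' vC] := u_sharp_lipschitz.
have C0 : 0 < `|C| + 1 by rewrite ltr_wpDl.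
have C'0 : 0 < `|C'| + 1 by rewrite ltr_wpDl.
(* Within distance [d] of the origin [u] rises by at most half the gap; [A] is the larger of the
   resulting bound and the one for [|x| >= d]. *)
pose d := Num.min pi ((v 0 - u 0) / 2 / (`|C| + 1)).
have d0 : 0 < d by rewrite lt_min p0 !divr_gt0// subr_gt0.
have dpi : d <= pi by rewrite ge_min lexx.
pose A := Num.max ((u 0 + v 0) / 2) ((1 - d ^+ 2 / pi ^+ 2) * v 0).
have Av : A < v 0.
  rewrite gt_max; apply/andP; split; first by lra.
  by rewrite gtr_pMl// gtrBl divr_gt0 ?exprn_gt0.
have A0 : 0 <= A by rewrite le_max; apply/orP; left; lra.
pose B := (A + v 0) / 2.
have uA x : Jpi x -> u x <= A.
  move=> Jx; have [xd|dx] := leP `|x| d.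
    rewrite le_max; apply/orP; left.
    have h : `|u x - u 0| <= (v 0 - u 0) / 2.
      apply: (le_trans (uC x 0)); rewrite subr0.
      apply: (@le_trans _ _ (`|x| * (`|C| + 1))).
        by rewrite ler_wpM2l// (le_trans (ler_norm _))// lerDl.
      by rewrite -ler_pdivlMr// (le_trans xd)// ge_min lexx orbT.
    by have := le_trans (ler_norm _) h; lra.
  have [ux|ux] := leP (u x) 0; first exact: le_trans A0.
  rewrite le_max; apply/orP; right.
  apply: (le_trans (u_meas_le_center (u_meas_gt0_Ipi Jx ux))).
  rewrite ler_pM2r// lerD2l lerN2 ler_pM2r ?invr_gt0 ?exprn_gt0//.
  rewrite -[leRHS]real_normK ?num_real//.
  by apply: lerXn2r; rewrite ?nnegrE//; exact: ltW.
exists A, B; split => //; first by rewrite /B; lra.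
(* On []0, e[] the Lipschitz bound keeps [v] above [B]; the minimum with [pi] keeps the interval
   inside [Jpi]. *)
pose e := Num.min pi ((v 0 - B) / (`|C'| + 1)).
have e0 : 0 < e by rewrite lt_min p0 divr_gt0// subr_gt0 /B; lra.
apply: (@lt_le_trans _ _ (lam `]0, e[%classic)).
  by rewrite lebesgue_measure_itv/= lte_fin e0 oppr0 adde0 lte_fin.
apply: le_measure; rewrite ?inE//.
  exact: (measurable_above (T := measurableTypeR R) measurable_Jpi B measurable_u_sharp).
move=> x; rewrite /= in_itv/= => /andP[x0 xe]; split.
  apply/JpiP; rewrite gtr0_norm//; apply/ltW/(lt_le_trans xe).
  by rewrite ge_min lexx.
have h : `|v 0 - v x| < v 0 - B.
  apply: (le_lt_trans (vC 0 x)); rewrite sub0r normrN gtr0_norm//.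
  apply: (@le_lt_trans _ _ (x * (`|C'| + 1))).
    by rewrite ler_pM2l// (le_trans (ler_norm _))// lerDl.
  by rewrite -ltr_pdivlMr//; apply: (lt_le_trans xe); rewrite ge_min lexx orbT.
by have := le_lt_trans (ler_norm _) h; lra.
Qed.

(** * The equality case, with the strictly decreasing weight [g = Green 0] *)

Let g (y : R) : R := (pi - `|y|) / 2.

Let sym_trapezoid0 y : sym_trapezoid 0 y = g y.
Proof. by rewrite /sym_trapezoid /g normr0 max_r. Qed.

Let mg D : measurable_fun D g.
Proof.
apply: measurable_funTS; apply: measurable_funM => //; apply: measurable_funB => //.
Qed.

Let g0 y : Ipi y -> 0 <= g y.
Proof. by move=> /IpiP/ltW h; rewrite /g divr_ge0// subr_ge0. Qed.

Let g_le y : g y <= pi / 2.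
Proof. by rewrite /g ler_pM2r// gerBl. Qed.

(** Both values at the origin split into a density term and a singular term, each at most its
    symmetrized counterpart, so both are equalities. The first is rigid by [rearrangement_rigidity];
    the second forces [g] to equal its maximum [s]-almost everywhere. *)
Lemma center_rigidity : v 0 <= u 0 ->
  {ae lam, forall x, Ipi x -> f x = fsharp f x} /\
  (forall A : set R, measurable A -> s A = (M%:E * \d_(0%R : R) A)%E).
Proof.
move=> vu; have p0 := pi_gt0 R.
have J0 : Jpi (0 : R) by apply/JpiP; rewrite normr0 ltW.
have I0oo : (lam Ipi0 < +oo)%E.
  apply: (@le_lt_trans _ _ (lam Ipi)); last by rewrite lebesgue_Ipi ltry.
  by apply: le_measure; rewrite ?inE//; exact: Ipi0_sub.
pose Fg := (\int[lam]_(y in Ipi0) (fsharp f y * g y)%:E)%E.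
pose fg := (\int[lam]_(y in Ipi0) (f y * g y)%:E)%E.
pose sg := (\int[s]_(y in Ipi) (g y)%:E)%E.
have M0 := singular_mass_ge0.
have v0E : (v 0)%:E = (Fg + (M * (pi / 2))%:E)%E.
  rewrite u_sharpE ?normr0 ?ltW// subr0; congr (_ + _)%E.
  by apply: eq_integral => y _; rewrite sym_trapezoid0.
have u0E : (u 0)%:E = (fg + sg)%E.
  rewrite /u_meas fineK; last exact: (integrable_fin_num mI (integrable_Green_mu 0)).
  transitivity (\int[mu]_(y in Ipi) (g y)%:E)%E.
    by apply: eq_integral => y _; rewrite Green0l.
  rewrite integral_decomp//; congr (_ + _)%E.
  rewrite integral_Ipi0; last by apply/measurable_EFinP; exact: measurable_funM.
  by apply: eq_integral => y _; rewrite mulrC.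
have fg0 : (0 <= fg)%E.
  by apply: integral_ge0 => y /Ipi0_sub Iy; rewrite lee_fin mulr_ge0// ?f_ge0 ?g0.
have sg0 : (0 <= sg)%E by apply: integral_ge0 => y Iy; rewrite lee_fin g0.
have cstE : (\int[s]_(y in Ipi) (cst (pi / 2)%:E) y = (M * (pi / 2))%:E)%E.
  by rewrite integral_cst// singular_IpiE -EFinM mulrC.
have gs : (sg <= (M * (pi / 2))%:E)%E.
  rewrite -cstE; apply: ge0_le_integral => //.
  - by apply/measurable_EFinP; exact: mg.
  - by move=> y _; rewrite /= lee_fin.
(* The condition [2 |x| < c] reads [g x > (pi - c / 2) / 2]. *)
have above_g t : exists c : R, Ipi0 `&` [set x | t < fsharp f x] = Ipi0 `&` [set x | c < g x].
  rewrite fsharp_above//; set c := fine _; exists ((pi - c / 2) / 2).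
  by apply/seteqP; split => y [Iy /= h]; split => //=; move: h; rewrite /g; lra.
have fgF : (fg <= Fg)%E.
  apply: hardy_littlewood => //.
  - exact: mg.
  - exact: mg.
  - by move=> y /Ipi0_sub; exact: f_ge0.
  - by move=> y /Ipi0_sub; exact: g0.
  - by move=> y /Ipi0_sub; exact: g0.
  - by move=> t _ /=; rewrite fsharp_above_measure// above_Ipi0_measure.
  - move=> t t' _ _; have [c ->] := above_g t.
    have [ct|tc] := leP c t'; [right|left] => y [Iy /= h]; split => //=.
      exact: le_lt_trans h.
    exact: lt_trans h.
have FgfgE : fg = Fg /\ sg = (M * (pi / 2))%:E.
  move: v0E u0E fgF gs fg0 sg0.
  case: fg => [a| |]; case: sg => [b| |]; case: Fg => [a'| |] //.
  rewrite -!EFinD !lee_fin => -[E1] [E2] h1 h2 _ _.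
  by split; congr EFin; lra.
have [fgE sgE] := FgfgE; split.
  have [N [mN N0 DN]] : {ae lam, forall x, Ipi0 x -> f x = fsharp f x}.
    apply: (@rearrangement_rigidity _ (measurableTypeR R) R lam Ipi0 mI0 f (fsharp f) g) => //.
    - exact: mg.
    - by move=> y /Ipi0_sub; exact: f_ge0.
    - by move=> y /Ipi0_sub; exact: g0.
    - apply: measurable_bounded_integrable => //; first exact: mg.
      exists (pi / 2); split; first exact: num_real.
      move=> x xpi y /Ipi0_sub Iy /=; rewrite ger0_norm ?g0//.
      exact/(le_trans (g_le y))/ltW.
    - exact: integrable_fsharp0.
    - by move=> t _ /=; rewrite fsharp_above_measure// above_Ipi0_measure.
    - by rewrite -/Fg ltey; apply/eqP => Foo; move: v0E; rewrite Foo.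
  (* The removed origin is added to the exceptional null set. *)
  exists (N `|` [set 0]); split; first exact: measurableU.
    by rewrite measureU0//; exact: lebesgue_measure_set1.
  move=> x /= h; have [->|/eqP x0] := eqVneq x 0; [by right|left].
  by apply: DN => /= h'; apply: h => Ix; apply: h'.
have [N [mN N0 DN]] : {ae s, forall x, Ipi x -> (g x)%:E = (cst (pi / 2)%:E) x}.
  apply: ae_eq_of_le_integral => //.
  - by apply/measurable_EFinP; exact: mg.
  - by move=> x _; rewrite lee_fin.
  - by rewrite cstE ltry.
  - by rewrite cstE.
(* The weight [g] attains [pi / 2] only at the origin, and [s] has no mass outside [Ipi]. *)
have sI0 : s (~` [set 0]) = 0%E.
  have : s (N `|` ~` Ipi) = 0%E.
    by rewrite measureU0//; exact: measurableC.
  apply: subset_measure0; [exact: measurableC|by apply: measurableU => //; exact: measurableC|].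
  move=> x /= x0; have [Ix|Ix] := pselect (Ipi x); [left|by right].
  apply: DN => /= /(_ Ix) [] /eqP; rewrite /g => h; apply: x0.
  apply/eqP; rewrite -normr_eq0; apply/eqP; move/eqP: h; lra.
have sE (A : set R) : measurable A -> s A = s (A `&` [set 0]).
  move=> mA; rewrite (measureDI s mA (measurable_set1 (0 : R))).
  rewrite [X in (X + _)%E](_ : _ = 0%E) ?add0e//.
  apply: (subset_measure0 _ _ _ sI0); [exact: measurableD|exact: measurableC|].
  by move=> x [].
move=> A mA; rewrite sE// diracE -singular_IpiE (sE Ipi)//.
have -> : Ipi `&` [set 0] = [set 0] :> set R.
  by apply/seteqP; split => [x []//|x ->]; split => //; exact: Ipi_zero.
case: (boolP (0 \in A)) => [/set_mem A0|/negP A0].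
  by rewrite mule1; congr (s _); apply/seteqP; split => [x []//|x ->].
rewrite mule0 [X in s X](_ : _ = set0) ?measure0//.
by apply/seteqP; split => // x [Ax x0]; apply: A0; apply/mem_set; rewrite -x0.
Qed.

(** The mass [M] equals [c], and both terms of the potential agree at every point, so all norms
    agree at once. *)
Lemma u_meas_eq_u_sharp (c : R) : 0 <= c ->
  {ae lam, forall x, Ipi x -> f x = fsharp f x} ->
  (forall A : set R, measurable A -> s A = (c%:E * \d_(0%R : R) A)%E) ->
  forall x, Jpi x -> u x = v x.
Proof.
move=> c0 fF sE x /JpiP xpi.
have Mc : M = c.
  by rewrite /M sE// diracE mem_set ?mule1//; exact: Ipi_zero.
have Gx0 y : Ipi y -> 0 <= Green x y by move=> /Ipi_norm ypi; rewrite Green_ge0.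
rewrite /u_sharp Mc /u_meas integral_decomp//; last exact: measurable_Green.
have -> : (\int[s]_(y in Ipi) (Green x y)%:E = (c * Green x 0)%:E)%E.
  pose k := NngNum c0.
  rewrite (@eq_measure_integral _ _ _ _ (mscale k (dirac (0%R : R)))); last first.
    by move=> A mA _; rewrite sE.
  rewrite ge0_integral_mscale//; last by apply/measurable_EFinP; exact: measurable_Green.
  rewrite integral_dirac//; last by apply/measurable_EFinP; exact: measurable_Green.
  by rewrite diracE mem_set ?mul1e//; exact: Ipi_zero.
have -> : (\int[lam]_(y in Ipi) (Green x y * f y)%:E =
    \int[lam]_(y in Ipi) (Green x y * fsharp f y)%:E)%E.
  apply: ae_eq_integral => //.
  - by apply/measurable_EFinP; apply: measurable_funM => //; exact: measurable_Green.
  - exact: measurable_int (@integrable_Green _ (measurableTypeR R) R lam Ipi id (fsharp f) mI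
      (@measurable_id _ _ _) Ipi_norm integrable_fsharp x).
  - have [N [mN N0 DN]] := fF; exists N; split => // y /= h.
    by apply: DN => /= h'; apply: h => Iy; rewrite h'.
rewrite fineD//; apply: integrable_fin_num => //.
exact: (@integrable_Green _ (measurableTypeR R) R lam Ipi id (fsharp f) mI
  (@measurable_id _ _ _) Ipi_norm integrable_fsharp x).
Qed.
End Comparison.

Theorem theorem6p1 (R : realType)
  (mu : {measure set R -> \bar R})
  (mu_supp : mu (~` Ipi) = 0%E)
  (mu_fin : (mu setT < +oo)%E)
  (mu_nz : (0 < mu setT)%E)
  (f : R -> R) (s : {measure set R -> \bar R})
  (f_ge0 : forall x, Ipi x -> 0 <= f x)
  (f_int : lebesgue_measure.-integrable Ipi (EFin \o f))
  (s_supp : s (~` Ipi) = 0%E)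
  (s_sing : exists N : set R, measurable N /\ lebesgue_measure N = 0%E
                               /\ s (~` N) = 0%E)
  (decomp : forall A : set R, measurable A ->
      mu A = (\int[lebesgue_measure]_(x in A `&` Ipi) (f x)%:E + s A)%E) :
  let M := fine (s Ipi) in
  forall p : \bar R, (1 <= p)%E ->
    (Lnorm lebesgue_measure p (onJ (u_meas mu))
       <= Lnorm lebesgue_measure p (onJ (u_sharp f M)))%E /\
    (Lnorm lebesgue_measure p (onJ (u_meas mu))
       = Lnorm lebesgue_measure p (onJ (u_sharp f M))
     <-> ({ae lebesgue_measure, forall x, Ipi x -> f x = fsharp f x} /\
          exists c : R, 0 <= c /\
            forall A : set R, measurable A -> s A = (c%:E * (\d_(0%R : R) A))%E)).
Proof.
move=> M p p1.
have U0 x : Jpi x -> 0 <= u_meas mu x by exact: u_meas_ge0.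
have V0 x : Jpi x -> 0 <= u_sharp f M x by exact: u_sharp_ge0.
have mU := measurable_u_meas mu_fin.
have mV := measurable_u_sharp s f_ge0 f_int.
have UV := @superlevel_comparison _ _ _ _ mu_fin f_ge0 f_int decomp.
have le_norm := Lnorm_onJ_le mU mV U0 V0 UV p1.
split => //; split => [eq_norm|[fF [c [c0 sE]]]].
  (* A deficit at the origin would make the norms differ, so equality of norms leaves only the case
     of [center_rigidity]. *)
  have [uv|vu] := ltP (u_meas mu 0) (u_sharp f M 0).
    have [A [B [A0 AB UA VB]]] := strict_gap mu_fin f_ge0 f_int decomp uv.
    have VK x : Jpi x -> u_sharp f M x <= u_sharp f M 0.
      by move=> /JpiP xpi; apply: u_sharp_le => //; rewrite normr0.
    have := Lnorm_onJ_lt mU mV U0 V0 UV p1 A0 AB UA VK VB.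
    by rewrite eq_norm ltxx.
  have [fF sE] := center_rigidity mu_fin f_ge0 f_int s_supp decomp vu.
  by split => //; exists M; split => //; exact: fine_ge0.
apply: eq_Lnorm => x; rewrite /onJ; case: asboolP => // Jx; congr EFin.
exact: (u_meas_eq_u_sharp mu_fin f_ge0 f_int decomp c0 fF sE).
Qed.
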